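(* Let $\phi(x,y)=a_1x^2+a_2xy+a_3y^2$ with $a_i\in\mathbb{Q}$ and $a_2^2-4a_1a_3\ne0$, let $0<s<1$ and $C\ge1$. There exist constants $\epsilon=\epsilon(\phi,s)>0$, $K=K(s)>0$ and $c_0=c_0(\phi,s)>0$ such that the following holds for all $\delta>0$. Let $A\subset[0,1]$ be a $\delta$-separated set with $\#A=\lceil\delta^{-s}\rceil$ such that $\#(A\cap I)\le C\,l^s\,\#A$ for every interval $I$ of length $l\ge\delta$. Then for every $B\subseteq A$ with $\#B\ge\delta^\epsilon\#A$, $$\mathcal{E}_\delta(B+B)+\mathcal{E}_\delta(\phi(B,B))\ \ge\ c_0\,C^{-K}\,\delta^{-\epsilon}\,\#A,$$ where $B+B=\{b+b':b,b'\in B\}$ and $\phi(B,B)=\{\phi(b,b'):b,b'\in B\}$.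
   Context: $\mathcal{E}_\delta(E)$ denotes the $\delta$-covering number of $E\subset\mathbb{R}$ (minimal number of intervals of length $\delta$ covering $E$). A set is $\delta$-separated if distinct points are at distance $\ge\delta$. *)

(* Defs.v *)
(* concrete reals R, finite sets of reals as duplicate-free lists. *)
From Stdlib Require Import Reals QArith Qreals List ZArith ClassicalEpsilon.
Open Scope R_scope.

Definition Rceil (x : R) : Z := (1 - up (- x))%Z.

Definition covered_by (delta : R) (E : R -> Prop) (L : list R) : Prop :=
  forall x, E x -> exists c, In c L /\ c <= x <= c + delta.

Definition coverable (delta : R) (E : R -> Prop) (n : nat) : Prop :=
  exists L : list R, length L = n /\ covered_by delta E L.

(* delta-covering number: the minimal number of intervals of length delta
   covering E (well defined whenever some finite cover exists, e.g. E finite). *)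
Definition covering_number (delta : R) (E : R -> Prop) : nat :=
  epsilon (inhabits 0%nat)
    (fun n => coverable delta E n /\ forall m, coverable delta E m -> (n <= m)%nat).

Definition delta_separated (delta : R) (A : list R) : Prop :=
  forall a b, In a A -> In b A -> a <> b -> delta <= Rabs (a - b).

Definition count_in (A : list R) (x l : R) : nat :=
  length (filter (fun a => if Rle_dec x a then
                             if Rle_dec a (x + l) then true else false
                           else false) A).

Definition sumset (B : list R) : R -> Prop :=
  fun z => exists b b', In b B /\ In b' B /\ z = b + b'.

Definition qform (a1 a2 a3 : Q) (x y : R) : R :=
  Q2R a1 * x ^ 2 + Q2R a2 * x * y + Q2R a3 * y ^ 2.

Definition qform_set (a1 a2 a3 : Q) (B : list R) : R -> Prop :=
  fun z => exists b b', In b B /\ In b' B /\ z = qform a1 a2 a3 b b'.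

(* Main.v *)
(* Rescale so that delta = 1: the set becomes a set A of n integers in [0, N]. If
   A + A and phi(A, A) are small, Cauchy-Schwarz gives about n^3 quadruples with
   |phi(x, y) - phi(x', y')| < N, and
     2 (phi(x, y) - phi(x', y')) = (x - x') w + (y - y') w',
   where w and w' are the two partial derivatives of phi at (x + x', y + y').
   They run through only about n integers, by Pluennecke. Hence for some fixed w
   there is a set T of about n values w' such that dilation by t = w'/w maps A
   into few translates of A - A. Such t are closed under sums and differences at
   a controlled cost.

   Following Guth, Katz and Zahl, let Q be the set of the quotients
   (a - b)/(d - e) with a, b, d, e in T and |d - e| >= r N. If x is in Q then
   x/2 and (x + 1)/2 are close to Q: otherwise the map
   (u, v) |-> 2 (d - e) u + (a - b) v on T x T would have too few collisions for
   the size of its image, which is a short piece of a set covered by few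
   translates of A - A, hence small by the Frostman condition. Reading off binary digits, Q is dense
   in [0, 1]. So T + y T is small, at a slightly coarser scale, for every y in
   [0, 1]; averaging the number of collisions over y contradicts s < 1.

   Every loss is polynomial in one parameter M, a small power of N. *)
Require Import Defs.
From Stdlib Require Import Reals QArith Qreals List ZArith.
From Stdlib Require Import Lra Lia Psatz Classical ClassicalEpsilon Wf_nat.
From mathcomp Require Import all_boot zify.
From mathcomp.zify Require Import ssrZ.
Open Scope R_scope.
Set Implicit Arguments.
Unset Strict Implicit.
Unset Printing Implicit Defensive.

Local Open Scope nat_scope.

(** * Counting *)

(** The denominator [w] is common to all ratios, so it cancels in the quotients of differences of
    [T]; and a product of two elements of [T], once divided by [w], is a good ratio applied to a
    value of a linear form on [A]. Products are thereby reduced to dilations of [A]. The size [D] of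
    [d - e] is known only to lie between [r * N] and [2 * c * N]. The image of the map lies in an
    interval of length about [D], and a collision confines a pair to a strip of width about [N / D].
    The two Frostman factors, about [(D / N)^s] and [(1 / D)^s], multiply to [N^(-s)], so [D]
    disappears; this is why images are counted by a local bound and not by their total size. What
    remains is the gain [r^s] from the collisions with [|v - v'| < r * N], which beats every power
    of [M] lost on the way once [r] is a large negative power of [M]. *)

Lemma sum_eq_uniq (I : eqType) (U : seq I) (i : I) :
  uniq U -> i \in U -> \sum_(j <- U) (i == j : nat) = 1%N.
Proof.
move=> uU iU.
have -> : \sum_(j <- U) (i == j : nat) = count (pred1 i) U.
  by rewrite -sum1_count [RHS]big_mkcond /=; apply: eq_bigr => j _; rewrite eq_sym; case: eqP.
by rewrite count_uniq_mem // iU.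
Qed.

Lemma count_sum (T : Type) (P : pred T) (S : seq T) :
  count P S = \sum_(s <- S) (P s : nat).
Proof. by rewrite -sum1_count big_mkcond /=; apply: eq_bigr => j _; case: (P j). Qed.

Lemma size_fibers (T I : eqType) (f : T -> I) (S : seq T) (U : seq I) :
  uniq U -> {in S, forall s, f s \in U} ->
  size S = \sum_(i <- U) count (fun s => f s == i) S.
Proof.
move=> uU fU; under eq_bigr => i _ do rewrite count_sum.
rewrite exchange_big /= -sum1_size big_seq [RHS]big_seq.
by apply: eq_bigr => s sS; rewrite sum_eq_uniq // fU.
Qed.

(** Cauchy-Schwarz, from [2 * (c i * c j) <= c i ^ 2 + c j ^ 2] summed over all pairs. *)
Lemma sum_sqr_le (I : Type) (U : seq I) (c : I -> nat) :
  (\sum_(i <- U) c i) ^ 2 <= size U * \sum_(i <- U) c i ^ 2.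
Proof.
have E : \sum_(i <- U) \sum_(j <- U) 2 * (c i * c j) <=
         \sum_(i <- U) \sum_(j <- U) (c i ^ 2 + c j ^ 2).
  by apply: leq_sum => i _; apply: leq_sum => j _; exact: nat_Cauchy.
have L : \sum_(i <- U) \sum_(j <- U) 2 * (c i * c j) = 2 * (\sum_(i <- U) c i) ^ 2.
  rewrite expnS expn1 big_distrl big_distrr /=; apply: eq_bigr => i _.
  by rewrite -big_distrr -big_distrr.
have R : \sum_(i <- U) \sum_(j <- U) (c i ^ 2 + c j ^ 2) =
    2 * (size U * \sum_(i <- U) c i ^ 2).
  under eq_bigr => i _ do rewrite big_split /= big_const_seq count_predT iter_addn_0.
  rewrite big_split /= -big_distrl /= big_const_seq count_predT iter_addn_0; lia.
by move: E; rewrite L R leq_pmul2l.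
Qed.

(** The double sum counts colliding pairs, that is, it adds the squares of the fibre sizes, and
    Cauchy-Schwarz applies to the fibres. Every lower bound for collisions below comes from here. *)
Lemma size_sqr_le_collisions (T I : eqType) (f : T -> I) (S : seq T) (U : seq I) :
  uniq U -> {in S, forall s, f s \in U} ->
  size S ^ 2 <= size U * \sum_(s <- S) \sum_(s' <- S) (f s == f s' : nat).
Proof.
move=> uU fU.
have -> : \sum_(s <- S) \sum_(s' <- S) (f s == f s' : nat) =
          \sum_(i <- U) count (fun s => f s == i) S ^ 2.
  transitivity (\sum_(s <- S) \sum_(i <- U) (f s == i) * count (fun s => f s == i) S).
    rewrite big_seq [RHS]big_seq; apply: eq_bigr => s sS.
    have fs := fU s sS; rewrite (bigD1_seq (f s)) //= eqxx mul1n.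
    rewrite [X in (_ = _ + X)%N]big1 ?addn0 => [|j /negPf nj]; last by rewrite eq_sym nj.
    by rewrite count_sum; apply: eq_bigr => s' _; rewrite eq_sym.
  rewrite exchange_big /=; apply: eq_bigr => i _.
  by rewrite -big_distrl /= -count_sum expnS expn1.
rewrite {1}(size_fibers uU fU); exact: sum_sqr_le.
Qed.

Lemma size_le_fibers (T I : eqType) (f : T -> I) (S : seq T) (U : seq I) (h : nat) :
  uniq U -> {in S, forall s, f s \in U} ->
  {in U, forall i, count (fun s => f s == i) S <= h} -> size S <= size U * h.
Proof.
move=> uU fU hh; rewrite (size_fibers uU fU) big_seq.
apply: leq_trans (_ : \sum_(i <- U | i \in U) h <= _); first exact: leq_sum.
by rewrite -big_seq big_const_seq count_predT iter_addn_0 mulnC.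
Qed.

Lemma pigeonhole (T I : eqType) (f : T -> I) (S : seq T) (U : seq I) :
  S != [::] -> uniq U -> {in S, forall s, f s \in U} ->
  exists2 i, i \in U & size S <= size U * count (fun s => f s == i) S.
Proof.
move=> S0 uU fU.
case: (altP (@hasP _ (fun i => size S <= size U * count (fun s => f s == i) S) U)) => //.
move=> /hasPn H; exfalso; move: (size_fibers uU fU) => E.
have U0 : 0 < size U.
  by case: S S0 fU {H E} => // a S _ fU; have := fU a (mem_head _ _); case: U {uU fU}.
have : \sum_(i <- U) size U * count (fun s => f s == i) S + size U <= size U * size S.
  have -> : size U * size S = \sum_(i <- U) size S.
    by rewrite big_const_seq count_predT iter_addn_0 mulnC.
  rewrite -[X in _ + X](sum1_size U) -big_split /= big_seq [leqRHS]big_seq.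
  by apply: leq_sum => i iU; have := H i iU; rewrite -ltnNge addn1.
by rewrite -big_distrr /= -E; lia.
Qed.

(** The fibres of size at most [t] contribute at most [size U * t] together, each of the others at
    most [h]. With [t] half of an average, half of [S] is left to the popular values. *)
Lemma popular_values (T I : eqType) (f : T -> I) (S : seq T) (U : seq I) (h t : nat) :
  uniq U -> {in S, forall s, f s \in U} ->
  {in U, forall i, count (fun s => f s == i) S <= h} ->
  size S <= size U * t + size [seq i <- U | t < count (fun s => f s == i) S] * h.
Proof.
move=> uU fU hh; rewrite (size_fibers uU fU).
rewrite size_filter count_sum big_distrl /=.
have -> : size U * t = \sum_(i <- U) t.
  by rewrite big_const_seq count_predT iter_addn_0 mulnC.
rewrite -big_split /= big_seq [leqRHS]big_seq; apply: leq_sum => i iU.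
have := hh i iU; case: ltnP => //=; lia.
Qed.

Lemma maximal_independent (T : eqType) (r : rel T) (A : seq T) :
  reflexive r -> symmetric r -> uniq A ->
  exists F : seq T, [/\ uniq F, {subset F <= A},
    {in F &, forall x y, r x y -> x = y} & {in A, forall a, exists2 f, f \in F & r a f}].
Proof.
move=> rr rs; elim: A => [|a A IH] /=; first by exists [::].
case/andP=> aA /IH [F [uF FA iF cF]].
have [/hasP[f fF raf]|/hasPn nF] := boolP (has (r a) F).
  exists F; split=> //; first by move=> x /FA; rewrite inE orbC => ->.
  by move=> x; rewrite inE => /orP[/eqP->|/cF //]; exists f.
exists (a :: F); split=> //=.
- by rewrite uF andbT; apply: contra aA => /FA.
- by move=> x; rewrite !inE => /orP[->//|/FA->]; rewrite orbT.
- move=> x y; rewrite !inE => /orP[/eqP->|xF] /orP[/eqP->|yF] //.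
  + by move=> ray; have := nF y yF; rewrite ray.
  + by rewrite rs => rax; have := nF x xF; rewrite rax.
  + exact: iF.
- move=> x; rewrite inE => /orP[/eqP->|/cF[f fF rf]].
    by exists a; rewrite ?mem_head.
  by exists f => //; rewrite inE fF orbT.
Qed.

(** * Sumsets of integers *)

Definition sums (A B : seq Z) : seq Z := undup [seq (a + b)%Z | a <- A, b <- B].
Definition diffs (A B : seq Z) : seq Z := undup [seq (a - b)%Z | a <- A, b <- B].

Lemma sumsP A B z :
  reflect (exists a b, [/\ a \in A, b \in B & z = (a + b)%Z]) (z \in sums A B).
Proof.
rewrite mem_undup; apply: (iffP allpairsP) => [[[a b] [/= aA bB ->]]|[a [b [aA bB ->]]]].
  by exists a, b.
by exists (a, b).
Qed.

Lemma diffsP A B z :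
  reflect (exists a b, [/\ a \in A, b \in B & z = (a - b)%Z]) (z \in diffs A B).
Proof.
rewrite mem_undup; apply: (iffP allpairsP) => [[[a b] [/= aA bB ->]]|[a [b [aA bB ->]]]].
  by exists a, b.
by exists (a, b).
Qed.

Lemma mem_sums A B a b : a \in A -> b \in B -> (a + b)%Z \in sums A B.
Proof. by move=> aA bB; apply/sumsP; exists a, b. Qed.

Lemma sums_uniq A B : uniq (sums A B). Proof. exact: undup_uniq. Qed.
Lemma diffs_uniq A B : uniq (diffs A B). Proof. exact: undup_uniq. Qed.

Lemma sumsS A A' B : {subset A <= A'} -> {subset sums A B <= sums A' B}.
Proof. by move=> s z /sumsP[a [b [aA bB ->]]]; apply: mem_sums => //; exact: s. Qed.

Lemma sumsA A B C : sums A (sums B C) =i sums (sums A B) C.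
Proof.
move=> z; apply/sumsP/sumsP.
  by move=> [a [_ [aA /sumsP[b [c [bB cC ->]]] ->]]]; exists (a + b)%Z, c;
    rewrite mem_sums //; split => //; lia.
by move=> [_ [c [/sumsP[a [b [aA bB ->]]] cC ->]]]; exists a, (b + c)%Z;
  rewrite mem_sums //; split => //; lia.
Qed.

Lemma size_uniq_eqi (s t : seq Z) : uniq s -> uniq t -> s =i t -> size s = size t.
Proof.
move=> us ut e; apply/eqP; rewrite eqn_leq; apply/andP.
by split; apply: uniq_leq_size => // x; rewrite e.
Qed.

(** Petridis' choice: as long as some subset has a strictly smaller ratio |X + A| / |X|, pass to it;
    the size drops each time. Ratios are cross-multiplied to stay in [nat]. *)
Lemma exists_minimal_growth (A X : seq Z) : X != [::] -> uniq X ->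
  exists X' : seq Z, [/\ {subset X' <= X}, X' != [::], uniq X',
    size (sums X' A) * size X <= size (sums X A) * size X' &
    forall W, uniq W -> {subset W <= X'} ->
      size (sums X' A) * size W <= size (sums W A) * size X'].
Proof.
elim: {X}(size X) {-2}X (leqnn (size X)) => [|n IH] X sX X0 uX.
  by case: X X0 sX {uX}.
case: (classic (forall W, uniq W -> {subset W <= X} ->
      size (sums X A) * size W <= size (sums W A) * size X)) .
  by move=> H; exists X; split.
move=> nH.
have [W] := not_all_ex_not _ _ nH.
move=> /(@imply_to_and (uniq W))[uW] /(@imply_to_and {subset W <= X})[WX] /negP.
rewrite -ltnNge => lt.
have W0 : W != [::] by case: W lt {uW WX} => //=; rewrite muln0.
have sW : size W < size X.
  rewrite ltn_neqAle uniq_leq_size // andbT; apply: contraL lt => /eqP eW.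
  rewrite -leqNgt eW leq_mul2r; apply/orP; right.
  apply: uniq_leq_size; first exact: sums_uniq.
  have [_ e] := uniq_min_size uW WX (eq_leq (esym eW)).
  by apply: sumsS => x; rewrite e.
have [X' [X'W X'0 uX' gr mi]] := IH W (leq_trans sW sX) W0 uW.
exists X'; split => //; first by move=> x /X'W/WX.
have W0' : 0 < size W by case: (W) W0.
rewrite -(leq_pmul2r W0') mulnAC [leqRHS]mulnAC.
apply: leq_trans (leq_mul gr (leqnn (size X))) _.
by rewrite mulnAC leq_mul // ltnW.
Qed.

(** Induction on [C]. Let W collect the [x] with [x + c] already in X + C. A new [c] adds to X + A +
    C only translates of points of X + A outside W + A, while it adds at least |X| - |W| points to X
    + C. Minimality bounds |W + A| below by |W| |X + A| / |X|, which balances the two. *)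
Lemma petridis (A X C : seq Z) : uniq X ->
  (forall W, uniq W -> {subset W <= X} ->
      size (sums X A) * size W <= size (sums W A) * size X) ->
  size (sums (sums X A) C) * size X <= size (sums X A) * size (sums X C).
Proof.
move=> uX mi; have arith (a w b xa xc xcc k x : nat) : xa * k <= w * x -> b * x <= xa * xc ->
    a + w <= b + xa -> xc + x <= xcc + k -> a * x <= xa * xcc by nia.
elim: C => [|c C IH].
  have nilE Y : sums Y [::] = [::] by rewrite /sums; elim: Y.
  by rewrite !nilE.
pose W := [seq x <- X | (x + c)%Z \in sums X C].
have WX : {subset W <= X} by exact: mem_subseq (filter_subseq _ _).
have uW : uniq W by exact: filter_uniq.
have miW := mi W uW WX.
have S1 : size (sums (sums X A) (c :: C)) + size (sums W A) <=
          size (sums (sums X A) C) + size (sums X A).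
  have -> : size (sums X A) = size [seq s <- sums X A | s \notin sums W A] + size (sums W A).
    rewrite -(count_predC (mem (sums W A)) (sums X A)) addnC; congr (_ + _).
      by rewrite size_filter.
    rewrite -size_filter; apply: size_uniq_eqi => [||z].
    - exact: filter_uniq (sums_uniq _ _).
    - exact: sums_uniq.
    - by rewrite mem_filter; apply: andb_idr => /(sumsS WX).
  rewrite addnA leq_add2r.
  rewrite -[X in _ <= _ + X](size_map (fun s => s + c)%Z) -size_cat.
  apply: uniq_leq_size => [|z]; first exact: sums_uniq.
  case/sumsP=> [s [d [sS]]]; rewrite inE mem_cat => /orP[/eqP-> ->|dC ->]; last first.
    by rewrite mem_sums.
  have [sW|sW] := boolP (s \in sums W A); last first.
    by apply/orP; right; apply: map_f; rewrite mem_filter sW.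
  apply/orP; left; case/sumsP: sW => [w [a [wW aA ->]]].
  move: wW; rewrite mem_filter => /andP[/sumsP[x [e [xX eC xe]]] _].
  have -> : (w + a + c = x + a + e)%Z by lia.
  by rewrite !mem_sums.
have S2 : size (sums X C) + size X <= size (sums X (c :: C)) + size W.
  have -> : size X = size [seq x <- X | (x + c)%Z \notin sums X C] + size W.
    by rewrite !size_filter addnC count_predC.
  rewrite addnA leq_add2r -[X in _ + X <= _](size_map (fun s => s + c)%Z) -size_cat.
  apply: uniq_leq_size => [|z].
    rewrite cat_uniq sums_uniq map_inj_uniq ?filter_uniq // => [|x y]; last lia.
    rewrite andbT; apply/hasPn => z /mapP[x]; rewrite mem_filter => /andP[nx _] ->.
    exact: nx.
  rewrite mem_cat => /orP[/sumsP[x [d [xX dC ->]]]|/mapP[x]].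
    by rewrite mem_sums // inE dC orbT.
  by rewrite mem_filter => /andP[_ xX] ->; rewrite mem_sums // mem_head.
apply: arith miW IH S1 S2.
Qed.

(** Send [(d, x)] to [(x + u, x + v)], where [(u, v)] is a chosen representation of [d]: the
    difference of the coordinates returns [d], hence [(u, v)], hence [x]. *)
Lemma ruzsa_triangle (U V X : seq Z) : uniq X ->
  size (diffs U V) * size X <= size (sums X U) * size (sums X V).
Proof.
move=> uX.
(* The default pair is never reached for [d] in [diffs U V]. *)
pose g d : Z * Z := head (0, 0)%Z [seq p <- [seq (u, v) | u <- U, v <- V] | (p.1 - p.2)%Z == d].
have gP d : d \in diffs U V -> [/\ (g d).1 \in U, (g d).2 \in V & ((g d).1 - (g d).2)%Z = d].
  case/diffsP => u [v [uU vV ->]].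
  have : g (u - v)%Z \in [seq p <- [seq (u, v) | u <- U, v <- V] | (p.1 - p.2)%Z == (u - v)%Z].
    have : (u, v) \in [seq p <- [seq (u, v) | u <- U, v <- V] | (p.1 - p.2)%Z == (u - v)%Z].
      by rewrite mem_filter /= eqxx; apply/allpairsP; exists (u, v).
    by rewrite /g; case: [seq _ <- _ | _] => //= p s _; rewrite mem_head.
  by rewrite mem_filter => /andP[/eqP-> /allpairsP[[u' v'] [/= uU' vV' ->]]].
have -> : size (diffs U V) * size X =
    size [seq ((x + (g d).1)%Z, (x + (g d).2)%Z) | d <- diffs U V, x <- X].
  by rewrite size_allpairs.
have -> : size (sums X U) * size (sums X V) =
    size [seq (a, b) | a <- sums X U, b <- sums X V].
  by rewrite size_allpairs.
apply: uniq_leq_size.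
  apply: allpairs_uniq => //; first exact: diffs_uniq.
  move=> [d x] [d' x'] /allpairsP[[d1 x1] [/= dD xX [-> ->]]].
  move=> /allpairsP[[d2 x2] [/= dD' xX' [-> ->]]].
  case=> e1 e2; have [_ _ E] := gP _ dD; have [_ _ E'] := gP _ dD'.
  have dd : d1 = d2 by rewrite -E -E'; lia.
  by rewrite dd in e1 *; congr pair; lia.
move=> _ /allpairsP[[d x] [/= dD xX ->]]; have [U' V' _] := gP _ dD.
by apply/allpairsP; exists ((x + (g d).1)%Z, (x + (g d).2)%Z); rewrite !mem_sums.
Qed.

(** Take [F] maximal in [E] with pairwise disjoint translates [f + Y]: disjointness inside [S] gives
    the size bound, maximality the covering. *)
Lemma ruzsa_covering (E Y S : seq Z) : uniq E -> uniq Y -> Y != [::] ->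
  (forall e y, e \in E -> y \in Y -> (e + y)%Z \in S) ->
  exists F : seq Z, [/\ {subset F <= E}, size F * size Y <= size S &
    {in E, forall e, exists f y y', [/\ f \in F, y \in Y, y' \in Y & e = (f + y - y')%Z]}].
Proof.
move=> uE uY Y0 ES.
pose r e f := has (fun y => has (fun y' => (e + y)%Z == (f + y')%Z) Y) Y.
have rP e f : reflect (exists y y', [/\ y \in Y, y' \in Y & (e + y = f + y')%Z]) (r e f).
  apply: (iffP hasP) => [[y yY /hasP[y' yY' /eqP e']]|[y [y' [yY yY' e']]]].
    by exists y, y'.
  by exists y => //; apply/hasP; exists y' => //; apply/eqP.
have rr : reflexive r.
  by move=> e; apply/rP; case: (Y) Y0 => // y Y' _; exists y, y; rewrite mem_head.
have rs : symmetric r.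
  by move=> e f; apply/rP/rP => -[y [y' [yY yY' e']]]; exists y', y.
have [F [uF FE iF cF]] := maximal_independent rr rs uE.
exists F; split => //; last first.
  move=> e /cF[f fF /rP[y [y' [yY yY' e']]]]; exists f, y', y; split => //; lia.
rewrite -(size_allpairs Z.add F Y); apply: uniq_leq_size.
  apply: allpairs_uniq => // -[f y] [f' y'] /allpairsP[[f1 y1] [/= fF yY [-> ->]]].
  move=> /allpairsP[[f2 y2] [/= fF' yY' [-> ->]]] /= e.
  have ff : f1 = f2 by apply: iF => //; apply/rP; exists y1, y2.
  by rewrite ff in e *; congr pair; lia.
by move=> _ /allpairsP[[f y] [/= fF yY ->]]; apply: ES => //; exact: FE.
Qed.

Local Open Scope R_scope.

Lemma INR_leq m n : (m <= n)%N -> INR m <= INR n.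
Proof. by move=> /leP; exact: le_INR. Qed.

Lemma Rmult_ge1 x y : 1 <= x -> 1 <= y -> 1 <= x * y.
Proof. by move=> x1 y1; nra. Qed.

Lemma INR_addn m n : INR (m + n)%N = INR m + INR n.
Proof. exact: plus_INR. Qed.

Lemma INR_muln m n : INR (m * n)%N = INR m * INR n.
Proof. exact: mult_INR. Qed.

Lemma INR_size_gt0 (T : Type) (s : seq T) : size s != 0%N -> 0 < INR (size s).
Proof. by case: (size s) => // n _; apply: lt_0_INR; lia. Qed.

(* [A - A] is an approximate group, with constants powers of [K]. *)
Definition approximate (A : seq Z) (K : R) : Prop :=
  [/\ uniq A, A != [::], INR (size (diffs A A)) <= K ^ 2 * INR (size A) &
  exists F : seq Z, INR (size F) <= K ^ 5 /\
    forall a b c d, a \in A -> b \in A -> c \in A -> d \in A ->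
    exists f a' b', [/\ f \in F, a' \in A, b' \in A & (a - b + (c - d) = f + (a' - b'))%Z]].

(** A minimal [X] has |X + jA| <= K^j |X| by [petridis]. The triangle inequality then bounds |A - A|
    by [K ^ 2] and |3A - 2A| by [K ^ 5] times |X|; the latter is what covering 2A - 2A by translates
    of A - A costs. *)
Lemma approximate_of_doubling (A : seq Z) (K : R) :
  uniq A -> A != [::] -> INR (size (sums A A)) <= K * INR (size A) -> approximate A K.
Proof.
move=> uA A0 AK.
have nA : 0 < INR (size A) by apply: INR_size_gt0; case: (A) A0.
have [X [XA X0 uX gr mi]] := exists_minimal_growth A A0 uA.
have nX : 0 < INR (size X) by apply: INR_size_gt0; case: (X) X0.
have K0 : 0 <= K.
  apply: (Rmult_le_reg_r (INR (size A))) => //; rewrite Rmult_0_l.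
  by apply: Rle_trans AK; exact: pos_INR.
have xa : INR (size (sums X A)) <= K * INR (size X).
  apply: (Rmult_le_reg_r (INR (size A))) => //.
  have := INR_leq gr; rewrite !INR_muln => gr'; apply: Rle_trans gr' _.
  have := Rmult_le_compat_r _ _ _ (Rlt_le _ _ nX) AK; lra.
have xac C : INR (size (sums (sums X A) C)) <= K * INR (size (sums X C)).
  apply: (Rmult_le_reg_r (INR (size X))) => //.
  have := INR_leq (petridis C uX mi); rewrite !INR_muln => h; apply: Rle_trans h _.
  have := Rmult_le_compat_r _ _ _ (pos_INR (size (sums X C))) xa; lra.
have eqs B C : size (sums X (sums B C)) = size (sums (sums X B) C).
  by apply: size_uniq_eqi; rewrite ?sums_uniq //; exact: sumsA.
have x2 : INR (size (sums X (sums A A))) <= K ^ 2 * INR (size X).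
  rewrite eqs; apply: Rle_trans (xac A) _.
  have := Rmult_le_compat_l _ _ _ K0 xa; lra.
have x3 : INR (size (sums X (sums A (sums A A)))) <= K ^ 3 * INR (size X).
  rewrite eqs; apply: Rle_trans (xac _) _.
  have := Rmult_le_compat_l _ _ _ K0 x2; lra.
have tri U V u v : INR (size (sums X U)) <= u * INR (size X) ->
    INR (size (sums X V)) <= v * INR (size X) ->
    INR (size (diffs U V)) <= u * v * INR (size X).
  move=> Uu Vv; apply: (Rmult_le_reg_r (INR (size X))) => //.
  have := INR_leq (ruzsa_triangle U V uX); rewrite !INR_muln => h; apply: Rle_trans h _.
  have := Rmult_le_compat _ _ _ _ (pos_INR _) (pos_INR _) Uu Vv; lra.
have XA' : INR (size X) <= INR (size A) by apply/INR_leq/uniq_leq_size.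
split => //.
  apply: Rle_trans (tri _ _ _ _ xa xa) _.
  have := Rmult_le_compat_l _ _ _ (pow2_ge_0 K) XA'; lra.
have S32 := tri _ _ _ _ x3 x2.
have [|F [_ sF cF]] := ruzsa_covering (S := diffs (sums A (sums A A)) (sums A A))
    (diffs_uniq (sums A A) (sums A A)) uA A0.
  move=> e y /diffsP[_ [v [/sumsP[a [b [aA bA ->]]] vA ->]]] yA.
  by apply/diffsP; exists (y + (a + b))%Z, v; rewrite !mem_sums //; split => //; lia.
exists F; split.
  apply: (Rmult_le_reg_r (INR (size A))) => //.
  have := INR_leq sF; rewrite !INR_muln => h; apply: Rle_trans h _.
  apply: Rle_trans S32 _.
  have := Rmult_le_compat_l _ _ _ (pow_le _ 5 K0) XA'; lra.
move=> a b c d aA bA cA dA.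
have E : (a - b + (c - d))%Z \in diffs (sums A A) (sums A A).
  by apply/diffsP; exists (a + c)%Z, (b + d)%Z; rewrite !mem_sums //; split => //; lia.
have [f [y [y' [fF yA yA' ->]]]] := cF _ E.
by exists f, y, y'; split => //; rewrite Z.add_sub_assoc.
Qed.

(** * Integer parts and coverings by translates of A - A *)

(* Opaque, unlike [Int_part], whose subtraction [plus_IZR] would rewrite. *)
Fact floor_sig (x : R) : {z : Z | IZR z <= x < IZR z + 1}.
Proof. exists (Int_part x); have [] := base_Int_part x; lra. Qed.

Definition floor (x : R) : Z := sval (floor_sig x).

Lemma floor_spec x : IZR (floor x) <= x < IZR (floor x) + 1.
Proof. exact: svalP (floor_sig x). Qed.

Lemma floor_eq x z : IZR z <= x < IZR z + 1 -> floor x = z.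
Proof.
move=> h; have h' := floor_spec x.
have : (z < floor x + 1)%Z by apply: lt_IZR; rewrite plus_IZR; lra.
have : (floor x < z + 1)%Z by apply: lt_IZR; rewrite plus_IZR; lra.
lia.
Qed.

Lemma floor_IZR z : floor (IZR z) = z.
Proof. by apply: floor_eq; lra. Qed.

Lemma floorD x y : floor (x + y) = (floor x + floor y)%Z \/ floor (x + y) = (floor x + floor y + 1)%Z.
Proof.
have hx := floor_spec x; have hy := floor_spec y.
case: (Rlt_le_dec (x + y) (IZR (floor x) + IZR (floor y) + 1)) => h; [left|right];
  apply: floor_eq; rewrite !plus_IZR; lra.
Qed.

Lemma floorDZ x z : floor (x + IZR z) = (floor x + z)%Z.
Proof. by apply: floor_eq; rewrite plus_IZR; have := floor_spec x; lra. Qed.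

Lemma floorN x : floor (- x) = (- floor x)%Z \/ floor (- x) = (- floor x - 1)%Z.
Proof.
have hx := floor_spec x.
case: (Req_dec x (IZR (floor x))) => h; [left|right]; apply: floor_eq;
  rewrite ?minus_IZR !opp_IZR; lra.
Qed.

(* [X] lies, up to integer parts, in at most [m] translates of [A - A]. *)
Definition covered (A : seq Z) (m : R) (X : R -> Prop) : Prop :=
  exists L : seq Z, INR (size L) <= m /\
    forall x, X x -> exists c a b, [/\ c \in L, a \in A, b \in A & floor x = (c + (a - b))%Z].

Lemma covered_sub A m m' (X Y : R -> Prop) :
  m <= m' -> (forall x, Y x -> X x) -> covered A m X -> covered A m' Y.
Proof.
move=> mm YX [L [sL cL]]; exists L; split; first lra.
by move=> x /YX; exact: cL.
Qed.

Lemma covered_opp A m X : covered A m X -> covered A (2 * m) (fun x => X (- x)).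
Proof.
move=> [L [sL cL]].
exists ([seq (- c)%Z | c <- L] ++ [seq (- c - 1)%Z | c <- L]); split.
  by rewrite size_cat !size_map INR_addn; lra.
move=> x /cL [c [a [b [cL' aA bA e]]]].
have := floorN (- x); rewrite Ropp_involutive => -[->|->]; rewrite e.
  by exists (- c)%Z, b, a; split => //; [rewrite mem_cat map_f | lia].
by exists (- c - 1)%Z, b, a; split => //; [rewrite mem_cat (map_f (fun c => - c - 1)%Z) ?orbT | lia].
Qed.

Section Covered.

Variables (A : seq Z) (K : R).
Hypothesis apA : approximate A K.

(** A sum of two differences is absorbed by the [K ^ 5] translates of [approximate]; the factor 2 is
    the carry in [floorD]. *)
Lemma covered_add m m' (X Y Z : R -> Prop) :
  (forall z, Z z -> exists x y, [/\ X x, Y y & z = x + y]) ->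
  covered A m X -> covered A m' Y -> covered A (2 * K ^ 5 * m * m') Z.
Proof.
have [_ _ _ [F [sF cF]]] := apA.
move=> ZXY [L [sL cL]] [L' [sL' cL']].
pose P := [seq (c.1 + c.2 + f)%Z | c <- [seq (c, c') | c <- L, c' <- L'], f <- F].
have sP : INR (size P) <= K ^ 5 * m * m'.
  rewrite !size_allpairs !INR_muln.
  have h : INR (size L) * INR (size L') <= m * m' by apply: Rmult_le_compat => //; exact: pos_INR.
  have h1 : 0 <= INR (size L) * INR (size L') by apply: Rmult_le_pos; exact: pos_INR.
  have := Rmult_le_compat _ _ _ _ h1 (pos_INR (size F)) h sF; lra.
exists (P ++ [seq (c + 1)%Z | c <- P]); split.
  by rewrite size_cat size_map INR_addn; lra.
move=> z /ZXY[x [y [/cL [c [a [b [cL1 aA bA e]]]] /cL' [c' [a' [b' [cL2 aA' bA' e']]]] ->]]].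
have [f [a1 [b1 [fF a1A b1A e1]]]] := cF _ _ _ _ aA bA aA' bA'.
have PP : (c + c' + f)%Z \in P.
  by apply/allpairsP; exists ((c, c'), f); split => //=; apply/allpairsP; exists (c, c').
have [->|->] := floorD x y; rewrite e e'.
  exists (c + c' + f)%Z, a1, b1; rewrite mem_cat PP; split => //.
  by move: e1; clear; lia.
exists (c + c' + f + 1)%Z, a1, b1; rewrite mem_cat (map_f (fun c => c + 1)%Z PP) orbT.
by split => //; move: e1; clear; lia.
Qed.

Lemma covered_self : covered A 1 (fun x => exists2 a, a \in A & x = IZR a).
Proof.
have [_ A0 _ _] := apA; case: (A) A0 => // a0 A' _; exists [:: a0]; split; first by rewrite /=; lra.
move=> x [a aA ->]; exists a0, a, a0; rewrite mem_head aA floor_IZR; split => //.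
  exact: mem_head.
lia.
Qed.

Lemma covered_mulnat m (X : R -> Prop) (k : nat) :
  covered A m X -> covered A ((2 * K ^ 5 * m) ^ k) (fun z => exists2 x, X x & z = INR k * x).
Proof.
move=> cX; elim: k => [|k IH].
  have [_ A0 _ _] := apA; case: (A) A0 => // a0 A' _; exists [:: 0%Z]; split; first by rewrite /=; lra.
  move=> z [x _ ->]; exists 0%Z, a0, a0; rewrite !mem_head /= Rmult_0_l floor_IZR.
  split => //; lia.
have -> : (2 * K ^ 5 * m) ^ k.+1 = 2 * K ^ 5 * m * (2 * K ^ 5 * m) ^ k by [].
apply: covered_add cX IH => z [x Xx ->]; exists x, (INR k * x); split => //.
  by exists x.
by rewrite S_INR; lra.
Qed.

Lemma covered_mulZ m (X : R -> Prop) (k : Z) : 1 <= K -> 1 <= m ->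
  covered A m X ->
  covered A (2 * (2 * K ^ 5 * m) ^ Z.abs_nat k) (fun z => exists2 x, X x & z = IZR k * x).
Proof.
move=> K1 m1 /(covered_mulnat (Z.abs_nat k)) cX.
have [k0|k0] : (0 <= k)%Z \/ (k < 0)%Z by lia.
  apply: covered_sub cX.
    have : 0 <= (2 * K ^ 5 * m) ^ Z.abs_nat k; last lra.
    by apply: pow_le; have := pow_R1_Rle K 5 K1; nra.
  move=> z [x Xx ->]; exists x => //.
  by rewrite INR_IZR_INZ; congr (IZR _ * _); lia.
apply: covered_sub (covered_opp cX); first lra.
move=> z [x Xx ->]; exists x => //.
rewrite INR_IZR_INZ Zabs2Nat.id_abs Z.abs_neq ?opp_IZR; last lia.
lra.
Qed.

Lemma covered_count m (X : R -> Prop) (zs : seq Z) :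
  covered A m X -> uniq zs -> (forall z, z \in zs -> exists2 x, X x & z = floor x) ->
  INR (size zs) <= m * (K ^ 2 * INR (size A)).
Proof.
have [_ _ dK _] := apA; move=> [L [sL cL]] uz zX.
have : (size zs <= size L * size (diffs A A))%N.
  rewrite -(size_allpairs Z.add); apply: uniq_leq_size => // z /zX[x /cL[c [a [b [cc aA bA e]]]] ->].
  apply/allpairsP; exists (c, (a - b)%Z); split => //=.
  by apply/diffsP; exists a, b.
move=> /INR_leq; rewrite INR_muln => h; apply: Rle_trans h _.
by apply: Rmult_le_compat => //; exact: pos_INR.
Qed.

End Covered.

(** * The Frostman condition and counts at smaller scales *)

Lemma Rpower_gt0 x s : 0 < Rpower x s. Proof. exact: exp_pos. Qed.

Lemma Rpower_mono s x y : 0 < s -> 0 < x -> x <= y -> Rpower x s <= Rpower y s.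
Proof. by move=> s0 x0 xy; apply: Rle_Rpower_l; lra. Qed.

Lemma Rpower_scale s c x : 0 < s <= 1 -> 1 <= c -> 0 < x -> Rpower (c * x) s <= c * Rpower x s.
Proof.
move=> s01 c1 x0; rewrite -Rpower_mult_distr; [|lra|lra].
apply: Rmult_le_compat_r; first exact: Rlt_le (Rpower_gt0 _ _).
rewrite -[X in _ <= X]Rpower_1; last lra.
by apply: Rle_Rpower; lra.
Qed.

(** Feeds real estimates to the fibre counts, which are stated in [nat]. *)
Lemma nat_floor x : 0 <= x -> exists h, INR h <= x /\ forall k, INR k <= x -> (k <= h)%N.
Proof.
move=> x0; exists (Z.to_nat (floor x)); have hx := floor_spec x.
have f0 : (0 <= floor x)%Z.
  have : (-1 < floor x)%Z by apply: lt_IZR; lra.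
  lia.
split; first by rewrite INR_IZR_INZ Z2Nat.id //; lra.
move=> k; rewrite INR_IZR_INZ => kx.
have : (Z.of_nat k < floor x + 1)%Z by apply: lt_IZR; rewrite plus_IZR; lra.
lia.
Qed.

Lemma size_ints_le (zs : seq Z) x l : 0 <= l -> uniq zs ->
  (forall z, z \in zs -> x <= IZR z <= x + l) -> INR (size zs) <= l + 1.
Proof.
move=> l0 uz zx.
(* [- floor (- x)] is the ceiling of [x]. *)
pose k := Z.to_nat (floor (x + l) - - floor (- x) + 1).
have : (size zs <= k)%N.
  rewrite -(size_iota 0 k) -(size_map (fun i => - floor (- x) + Z.of_nat i)%Z).
  apply: uniq_leq_size => // z zz; have h := zx z zz.
  have h1 := floor_spec (x + l); have h2 := floor_spec (- x).
  have z1 : (z < floor (x + l) + 1)%Z by apply: lt_IZR; rewrite plus_IZR; lra.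
  have z2 : (- floor (- x) - 1 < z)%Z by apply: lt_IZR; rewrite minus_IZR opp_IZR; lra.
  apply/mapP; exists (Z.to_nat (z - - floor (- x))); last lia.
  by rewrite mem_iota /k; lia.
move=> /INR_leq h; apply: Rle_trans h _; rewrite /k INR_IZR_INZ.
have h1 := floor_spec (x + l); have h2 := floor_spec (- x).
have [h|h] : (0 <= floor (x + l) - - floor (- x) + 1)%Z \/ (floor (x + l) - - floor (- x) + 1 < 0)%Z by lia.
  by rewrite Z2Nat.id // plus_IZR minus_IZR opp_IZR; lra.
have -> : Z.of_nat (Z.to_nat (floor (x + l) - - floor (- x) + 1)) = 0%Z by lia.
lra.
Qed.

(* [n] need not be the cardinality of [A]; the scale is normalised so that the
   points are integers in an interval of length [N]. *)
Definition frostman (s N C n : R) (A : seq Z) : Prop :=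
  forall x l, 1 <= l -> forall zs, uniq zs -> {subset zs <= A} ->
  (forall z, z \in zs -> x <= IZR z <= x + l) ->
  INR (size zs) <= C * Rpower (l / N) s * n.

Section LocalCount.

Variables (A : seq Z) (K s N C : R).
Hypothesis apA : approximate A K.
Hypothesis s01 : 0 < s < 1.
Hypothesis N0 : 0 < N.
Hypothesis C0 : 0 <= C.
Hypothesis frA : frostman s N C (INR (size A)) A.

(** Every point of [A] is within [L] of a maximal subset [I] with gaps above [L]. So [A] splits into
    |I| pieces of length [2 * L <= 6 * l], each small by the Frostman condition, and dividing by |A|
    bounds |I| below. *)
Lemma frostman_separated l : 1 <= l -> exists I : seq Z,
  [/\ uniq I, {subset I <= A}, {in I &, forall x y, Rabs (IZR (x - y)) <= l + 1 -> x = y} &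
    1 <= INR (size I) * (C * (6 * Rpower (l / N) s))].
Proof.
have [uA A0 _ _] := apA; move=> l1.
(* [L >= l + 1] keeps translates apart even after taking integer parts; [l >= 1] gives
   [L <= 3 * l]. *)
pose L := (floor l + 2)%Z; pose r (a b : Z) := (Z.abs (a - b) <=? L)%Z.
have hl := floor_spec l.
have L0 : (0 <= L)%Z by apply: le_IZR; rewrite plus_IZR; lra.
have hL : l + 1 <= IZR L <= 3 * l by rewrite plus_IZR; lra.
have rr : reflexive r by move=> x; rewrite /r; lia.
have rs : symmetric r by move=> x y; rewrite /r; lia.
have [I [uI IA iI cI]] : exists I : seq Z, [/\ uniq I, {subset I <= A},
    {in I &, forall x y, r x y -> x = y} & {in A, forall a, exists2 f, f \in I & r a f}]
  := maximal_independent rr rs uA.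
exists I; split => //.
  move=> x y xI yI h; apply: iI => //; rewrite /r; apply/Z.leb_le/le_IZR.
  by rewrite abs_IZR; lra.
have nA : 0 < INR (size A) by apply: INR_size_gt0; case: (A) A0.
have p0 := Rpower_gt0 (6 * l / N) s.
have [h [hle hmax]] : exists h, INR h <= C * Rpower (6 * l / N) s * INR (size A) /\
    forall k, INR k <= C * Rpower (6 * l / N) s * INR (size A) -> (k <= h)%N.
  by apply: nat_floor; apply: Rmult_le_pos; last lra; apply: Rmult_le_pos; lra.
pose g a := head 0%Z [seq f <- I | r a f].
have gP a : a \in A -> g a \in I /\ r a (g a).
  move=> /cI[f fI raf].
  have : g a \in [seq f <- I | r a f].
    have : f \in [seq f <- I | r a f] by rewrite mem_filter raf.
    by rewrite /g; case: [seq _ <- _ | _] => //= p t _; rewrite mem_head.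
  by rewrite mem_filter => /andP[].
have sA : (size A <= size I * h)%N.
  apply: (@size_le_fibers _ _ g) => // [a /gP[] //|i iI'].
  rewrite -size_filter; apply: hmax.
  apply: (frA (x := IZR i - IZR L)); first lra.
  - exact: filter_uniq.
  - by apply: mem_subseq; exact: filter_subseq.
  - move=> z; rewrite mem_filter => /andP[/eqP<- /gP[_]].
    rewrite /r => /Z.leb_le ab.
    have : (g z - L <= z <= g z + L)%Z by lia.
    move=> [/IZR_le + /IZR_le]; rewrite minus_IZR plus_IZR; lra.
apply: (Rmult_le_reg_r (INR (size A))) => //; rewrite Rmult_1_l.
have := INR_leq sA; rewrite INR_muln => h'; apply: Rle_trans h' _.
have le6 : Rpower (6 * l / N) s <= 6 * Rpower (l / N) s.
  have -> : 6 * l / N = 6 * (l / N) by field; lra.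
  apply: Rpower_scale; [lra|lra|].
  by apply: Rdiv_lt_0_compat; lra.
have h2 : INR h <= C * (6 * Rpower (l / N) s) * INR (size A).
  apply: Rle_trans hle _; apply: Rmult_le_compat_r; first lra.
  by apply: Rmult_le_compat_l.
have := Rmult_le_compat_l _ _ _ (pos_INR (size I)) h2; lra.
Qed.

(** The Frostman condition passes from [A] to every set with a small covering. The translates of
    [zs] by the points of [I] are disjoint, because any two values in [zs] differ by less than
    [l + 1], and all lie among the integer parts of X + A, which is itself covered. This bounds |zs|
    |I|, and |I| is large. *)
Lemma covered_local_count m (X : R -> Prop) l (zs : seq Z) :
  covered A m X -> 1 <= l -> (forall x y, X x -> X y -> Rabs (x - y) <= l) ->
  uniq zs -> (forall z, z \in zs -> exists2 x, X x & z = floor x) ->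
  INR (size zs) <= 12 * K ^ 7 * C * m * Rpower (l / N) s * INR (size A).
Proof.
move=> cX l1 Xl uz zX.
have [I [uI IA sepI nI]] := frostman_separated l1.
have cXA : covered A (2 * K ^ 5 * m * 1)
    (fun z => exists x y, [/\ X x, exists2 a, a \in A & y = IZR a & z = x + y]).
  refine (covered_add apA _ cX (covered_self apA)) => z [x [y [Xx Ay ->]]]; by exists x, y.
pose Z' := [seq (z + a)%Z | z <- zs, a <- I].
have uZ : uniq Z'.
  apply: allpairs_uniq => // -[z1 a1] [z2 a2] /allpairsP[[z a] [/= zz aI [-> ->]]].
  move=> /allpairsP[[z' a'] [/= zz' aI' [-> ->]]] /= e.
  have aa : a = a'.
    apply: sepI => //.
    have [x Xx ex] := zX _ zz; have [y Xy ey] := zX _ zz'.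
    have -> : (a - a' = z' - z)%Z by lia.
    have h1 := floor_spec x; have h2 := floor_spec y; have h3 := Xl _ _ Xy Xx.
    rewrite ex ey minus_IZR; move: h3; rewrite /Rabs; do 2 case: Rcase_abs; lra.
  by rewrite aa in e *; congr pair; lia.
have cnt := covered_count apA cXA uZ.
have {cnt} : INR (size Z') <= 2 * K ^ 5 * m * 1 * (K ^ 2 * INR (size A)).
  apply: cnt => _ /allpairsP[[z a] [/= zz aI ->]].
  have [x Xx ->] := zX _ zz; exists (x + IZR a); last by rewrite floorDZ.
  by exists x, (IZR a); split => //; exists a => //; exact: IA.
rewrite size_allpairs INR_muln => cnt.
set p := C * (6 * Rpower (l / N) s) in nI.
have p0 : 0 <= p.
  by have := Rpower_gt0 (l / N) s; rewrite /p => h; apply: Rmult_le_pos; lra.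
have h1 := Rmult_le_compat_l _ _ _ (pos_INR (size zs)) nI.
have h2 := Rmult_le_compat_r _ _ _ p0 cnt.
apply: Rle_trans (_ : INR (size zs) * (INR (size I) * p) <= _); first lra.
apply: Rle_trans (_ : INR (size zs) * INR (size I) * p <= _); first lra.
apply: Rle_trans h2 _; rewrite /p; right; ring.
Qed.

End LocalCount.

(** * Ratios that almost preserve the set *)

(** Costs of covering [k * X] and [k * (X + X) + l * (X + X)]; the latter takes four multiples and
    three additions. *)
Definition mulc (K m : R) (k : Z) : R := 2 * (2 * K ^ 5 * m) ^ Z.abs_nat k.
Definition formc (K m : R) (k l : Z) : R :=
  (2 * K ^ 5) ^ 3 * (mulc K m k) ^ 2 * (mulc K m l) ^ 2.

Lemma mulc_ge1 K m k : 1 <= K -> 1 <= m -> 1 <= mulc K m k.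
Proof.
move=> K1 m1; have := pow_R1_Rle K 5 K1 => K5.
have h : 1 <= 2 * K ^ 5 * m by nra.
have := pow_R1_Rle _ (Z.abs_nat k) h; rewrite /mulc; lra.
Qed.

Lemma formc_ge1 K m k l : 1 <= K -> 1 <= m -> 1 <= formc K m k l.
Proof.
move=> K1 m1; have K5 := pow_R1_Rle K 5 K1.
have h1 : 1 <= (2 * K ^ 5) ^ 3 by apply: pow_R1_Rle; lra.
have h2 := pow_R1_Rle _ 2 (mulc_ge1 k K1 m1).
have h3 := pow_R1_Rle _ 2 (mulc_ge1 l K1 m1).
rewrite /formc -[1]Rmult_1_l; apply: Rmult_le_compat => //; try lra.
by rewrite -[1]Rmult_1_l; apply: Rmult_le_compat => //; lra.
Qed.

Lemma covered_form A K m (X : R -> Prop) k l : approximate A K -> 1 <= K -> 1 <= m ->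
  covered A m X -> covered A (formc K m k l)
   (fun z => exists x x' y y', [/\ X x, X x', X y, X y' & z = IZR k * (x + x') + IZR l * (y + y')]).
Proof.
move=> apA K1 m1 cX.
have ck := covered_mulZ apA k K1 m1 cX; have cl := covered_mulZ apA l K1 m1 cX.
pose Xk := fun z => exists2 x, X x & z = IZR k * x.
pose Xl := fun z => exists2 x, X x & z = IZR l * x.
have kk := covered_add apA (Z := fun z => exists x y, [/\ Xk x, Xk y & z = x + y]) (fun z h => h) ck ck.
have ll := covered_add apA (Z := fun z => exists x y, [/\ Xl x, Xl y & z = x + y]) (fun z h => h) cl cl.
apply: covered_sub (covered_add apA (fun z h => h) kk ll).
  by rewrite /formc /mulc; right; ring.
move=> z [x [x' [y [y' [Xx Xx' Xy Xy' ->]]]]].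
exists (IZR k * x + IZR k * x'), (IZR l * y + IZR l * y'); split; last ring.
  by exists (IZR k * x), (IZR k * x'); split => //; [exists x|exists x'].
by exists (IZR l * y), (IZR l * y'); split => //; [exists y|exists y'].
Qed.

Lemma pair_count (T : Type) (r : T -> T -> bool) (P : seq T) :
  size [seq pq <- [seq (p, q) | p <- P, q <- P] | r pq.1 pq.2] =
  (\sum_(p <- P) \sum_(q <- P) (r p q : nat))%N.
Proof. by rewrite size_filter count_sum big_allpairs. Qed.

(** With the coefficients [2 * p1, p2] and [p2, 2 * p3] these are the partial derivatives of
    [qf p1 p2 p3]. *)
Definition lin (k l x y : Z) : Z := (k * x + l * y)%Z.

(* Restricting to pairs on which the linear form keeps a sign and is bounded
   below makes it bounded below on sums of pairs as well. *)
Lemma large_linear_form (A : seq Z) (s N C rho : R) (k l : Z) :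
  uniq A -> 0 < s < 1 -> 0 < N -> 0 < rho -> 1 <= 2 * rho * N ->
  frostman s N C (INR (size A)) A -> 0 <= C -> C * Rpower (2 * rho) s <= / 2 ->
  (k <> 0 \/ l <> 0)%Z ->
  exists (sg : Z) (P : seq (Z * Z)), [/\ (sg = 1 \/ sg = -1)%Z, uniq P,
    {in P, forall p, [/\ p.1 \in A, p.2 \in A & rho * N <= IZR (sg * lin k l p.1 p.2)]} &
    INR (size A) ^ 2 <= 4 * INR (size P)].
Proof.
move=> uA s01 N0 r0 rN fr C0 Cr kl.
pose AA := [seq (x, y) | x <- A, y <- A].
pose R0 := (- floor (- (rho * N)))%Z.
have hR : rho * N <= IZR R0 < rho * N + 1.
  by have := floor_spec (- (rho * N)); rewrite opp_IZR; lra.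
pose v (p : Z * Z) := lin k l p.1 p.2.
have uAA : uniq AA by apply: allpairs_uniq => // -[? ?] [? ?].
have memAA p : p \in AA -> p.1 \in A /\ p.2 \in A.
  by case/allpairsP=> -[x y] [/= xA yA ->].
pose bad := [seq p <- AA | (Z.abs (v p) <? R0)%Z].
pose pos := [seq p <- AA | (R0 <=? v p)%Z].
pose neg := [seq p <- AA | (R0 <=? - v p)%Z].
have n0 := pos_INR (size A).
have split3 : (size AA <= size bad + size pos + size neg)%N.
  rewrite !size_filter !count_sum -!big_split /= -sum1_size.
  apply: leq_sum => p _.
  case: Z.ltb_spec => // h1; case: Z.leb_spec => // h2; case: Z.leb_spec => // h3; lia.
(* A nonzero integer coefficient has absolute value at least 1, so with the other coordinate fixed
   its variable lies in an interval of length [2 * rho * N], which holds at most half of [A]. *)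
have sbad : INR (size bad) <= INR (size A) * (INR (size A) / 2).
  have [h [hle hmax]] := @nat_floor (INR (size A) / 2) ltac:(lra).
  have key zs x : uniq zs -> {subset zs <= A} ->
      (forall z, z \in zs -> x <= IZR z <= x + 2 * rho * N) -> (size zs <= h)%N.
    move=> uz zA zx; apply: hmax; apply: Rle_trans (fr x _ rN zs uz zA zx) _.
    have -> : 2 * rho * N / N = 2 * rho by field; lra.
    by have := Rmult_le_compat_r _ _ _ n0 Cr; lra.
  have babs p : p \in bad -> [/\ p.1 \in A, p.2 \in A & Rabs (IZR k * IZR p.1 + IZR l * IZR p.2) < rho * N].
    rewrite mem_filter => /andP[/Z.ltb_lt hv /memAA[]]; split => //.
    have : (Z.abs (v p) <= R0 - 1)%Z by lia.
    move=> /IZR_le; rewrite abs_IZR minus_IZR /v /lin plus_IZR !mult_IZR => hv2.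
    by apply: Rle_lt_trans hv2 _; lra.
  have ubad : uniq bad by exact: filter_uniq.
  apply: Rle_trans (_ : INR (size A * h)%N <= _).
    apply: INR_leq; have [k0|k0] : (k <> 0 \/ k = 0)%Z by lia.
      apply: (@size_le_fibers _ _ (fun p : Z * Z => p.2)) => // [p /babs[]//|y yA].
      rewrite -size_filter -(size_map fst).
      apply: (key _ (- (IZR l * IZR y) / IZR k - rho * N)).
      - rewrite map_inj_in_uniq ?filter_uniq // => -[x1 y1] [x2 y2].
        by rewrite !mem_filter /= => /andP[/eqP-> _] /andP[/eqP-> _] ->.
      - by move=> x /mapP[[x1 y1]]; rewrite mem_filter => /andP[_ /babs[xA _ _]] ->.
      - move=> x /mapP[[x1 y1]]; rewrite mem_filter /= => /andP[/eqP-> /babs[_ _ /=]] hx ->.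
        have : Rabs (IZR x1 - - (IZR l * IZR y) / IZR k) <= rho * N.
          have kn : IZR k <> 0 by apply: not_0_IZR.
          have -> : IZR x1 - - (IZR l * IZR y) / IZR k = (IZR k * IZR x1 + IZR l * IZR y) / IZR k by field.
          rewrite Rabs_mult Rabs_inv.
          have k1 : 1 <= Rabs (IZR k) by rewrite -abs_IZR; apply: IZR_le; lia.
          apply: (Rmult_le_reg_r (Rabs (IZR k))); first lra.
          rewrite Rmult_assoc Rinv_l; last lra.
          have : 0 < rho * N by apply: Rmult_lt_0_compat.
          nra.
        by rewrite /Rabs; case: Rcase_abs; lra.
    have l0 : (l <> 0)%Z by lia.
    apply: (@size_le_fibers _ _ (fun p : Z * Z => p.1)) => // [p /babs[]//|y yA].
    rewrite -size_filter -(size_map snd).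
    apply: (key _ (- (rho * N))).
    - rewrite map_inj_in_uniq ?filter_uniq // => -[x1 y1] [x2 y2].
      by rewrite !mem_filter /= => /andP[/eqP-> _] /andP[/eqP-> _] ->.
    - by move=> x /mapP[[x1 y1]]; rewrite mem_filter => /andP[_ /babs[_ xA _]] ->.
    - move=> x /mapP[[x1 y1]]; rewrite mem_filter /= => /andP[_ /babs[_ _ /=]] hx ->.
      move: hx; rewrite k0 Rmult_0_l Rplus_0_l Rabs_mult.
      have l1 : 1 <= Rabs (IZR l) by rewrite -abs_IZR; apply: IZR_le; lia.
      have y0 := Rabs_pos (IZR y1) => hx.
      have : Rabs (IZR y1) <= rho * N by nra.
      by rewrite /Rabs; case: Rcase_abs; lra.
  rewrite INR_muln; exact: Rmult_le_compat_l.
have tot : INR (size A) ^ 2 <= 2 * (INR (size pos) + INR (size neg)).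
  move: split3; rewrite size_allpairs => /INR_leq; rewrite !INR_addn INR_muln; lra.
have [h|h] : INR (size A) ^ 2 <= 4 * INR (size pos) \/ INR (size A) ^ 2 <= 4 * INR (size neg) by lra.
  exists 1%Z, pos; split => //; [by left|exact: filter_uniq|].
  move=> p; rewrite mem_filter => /andP[/Z.leb_le/IZR_le hp /memAA[]]; split => //.
  by rewrite Z.mul_1_l; apply: Rle_trans hp; lra.
exists (-1)%Z, neg; split => //; [by right|exact: filter_uniq|].
move=> p; rewrite mem_filter => /andP[/Z.leb_le/IZR_le hp /memAA[]]; split => //.
have -> : (-1 * lin k l p.1 p.2 = - v p)%Z by rewrite /v; case: (lin _ _ _ _).
by apply: Rle_trans hp; lra.
Qed.

Definition qf (p1 p2 p3 : Z) (x y : R) : R :=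
  IZR p1 * x ^ 2 + IZR p2 * x * y + IZR p3 * y ^ 2.

Lemma Rabs_le_interval x b e r : Rabs (x + b - e) <= r -> e - b - r <= x <= e - b - r + 2 * r.
Proof. by rewrite /Rabs; case: Rcase_abs; lra. Qed.

Lemma floor_div_inj N a b : 0 < N -> floor (a / N) = floor (b / N) -> Rabs (a - b) < N.
Proof.
move=> N0 e; have h1 := floor_spec (a / N); have h2 := floor_spec (b / N); rewrite -e in h2.
have -> : a - b = (a / N - b / N) * N by field; lra.
have : Rabs (a / N - b / N) < 1 by rewrite /Rabs; case: Rcase_abs; lra.
by rewrite Rabs_mult (Rabs_pos_eq N); nra.
Qed.

Definition form_values (A : seq Z) (k l : Z) (z : R) : Prop :=
  exists x x' y y', [/\ x \in A, x' \in A, y \in A, y' \in A & z = IZR (lin k l (x + x') (y + y'))].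

Lemma covered_form_values A K k l : approximate A K -> 1 <= K ->
  covered A (formc K 1 k l) (form_values A k l).
Proof.
move=> apA K1; apply: covered_sub (covered_form k l apA K1 (Rle_refl 1) (covered_self apA)).
  exact: Rle_refl.
move=> z [x [x' [y [y' [xA xA' yA yA' ->]]]]].
exists (IZR x), (IZR x'), (IZR y), (IZR y').
split; [by exists x|by exists x'|by exists y|by exists y'|].
by rewrite /lin plus_IZR !mult_IZR !plus_IZR.
Qed.

Lemma form_values_count A K k l (zs : seq Z) : approximate A K -> 1 <= K -> uniq zs ->
  (forall z, z \in zs -> form_values A k l (IZR z)) ->
  INR (size zs) <= formc K 1 k l * K ^ 2 * INR (size A).
Proof.
move=> apA K1 uz zW; rewrite Rmult_assoc.
apply: (covered_count apA (covered_form_values k l apA K1) uz) => z /zW zz.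
by exists (IZR z) => //; rewrite floor_IZR.
Qed.

(** Up to [r], dilation by [t] sends [Y] into [e - A], hence Y - Y into A - A. And [A] lies in at
    most [m * K] translates of Y - Y, since A + Y stays inside A + A. The two errors leave the
    integer base point in a window of length [4 * r + 1]. *)
Lemma covered_dilate (A Y : seq Z) (K m t e r : R) :
  approximate A K -> INR (size (sums A A)) <= K * INR (size A) ->
  uniq Y -> 0 <= r -> 0 < m -> {subset Y <= A} -> INR (size A) <= m * INR (size Y) ->
  (forall y, y \in Y -> exists2 x, x \in A & Rabs (IZR x + t * IZR y - e) <= r) ->
  covered A (m * K * (4 * r + 2)) (fun z => exists2 a, a \in A & z = t * IZR a).
Proof.
move=> [uA A0 _ _] AA uY r0 m0 YA AY tY.
have nA : 0 < INR (size A) by apply: INR_size_gt0; case: (A) A0.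
have Y0 : Y != [::] by case: (Y) AY => //=; nra.
have nY : 0 < INR (size Y) by apply: INR_size_gt0; case: (Y) Y0.
have [F [_ sF cF]] : exists F : seq Z, [/\ {subset F <= A}, (size F * size Y <= size (sums A A))%N &
    {in A, forall a, exists f y y', [/\ f \in F, y \in Y, y' \in Y & a = (f + y - y')%Z]}].
  by apply: ruzsa_covering => // a y aA /YA; exact: mem_sums.
have [h [hle hmax]] := @nat_floor (4 * r + 1) ltac:(lra).
pose L := [seq (floor (t * IZR f - 2 * r) + Z.of_nat i)%Z | f <- F, i <- iota 0 h.+1].
have K0 : 0 <= K.
  apply: (Rmult_le_reg_r (INR (size A))) => //; rewrite Rmult_0_l.
  by apply: Rle_trans AA; exact: pos_INR.
exists L; split.
  rewrite size_allpairs size_iota INR_muln S_INR.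
  apply: Rmult_le_compat; [exact: pos_INR|by have := pos_INR h; lra| |lra].
  apply: (Rmult_le_reg_r (INR (size Y))) => //.
  have := INR_leq sF; rewrite INR_muln => h'; apply: Rle_trans h' _; apply: Rle_trans AA _.
  have := Rmult_le_compat_l _ _ _ K0 AY; lra.
move=> _ [a aA ->].
have [f [y [y' [fF /tY[x xA hx] /tY[x' xA' hx'] ->]]]] := cF a aA.
pose c := (floor (t * IZR (f + y - y')) - (x' - x))%Z.
have hc := floor_spec (t * IZR (f + y - y')).
have hf := floor_spec (t * IZR f - 2 * r).
have c1 : t * IZR f - 2 * r - 1 < IZR c <= t * IZR f + 2 * r.
  move: hc hx hx'; rewrite /c !minus_IZR plus_IZR /Rabs; do 2 case: Rcase_abs; lra.
have c2 : (floor (t * IZR f - 2 * r) - 1 < c)%Z.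
  by apply: lt_IZR; rewrite minus_IZR; lra.
exists c, x', x; split => //; last by rewrite /c; lia.
have ci : Z.to_nat (c - floor (t * IZR f - 2 * r)) \in iota 0 h.+1.
  rewrite mem_iota /= add0n ltnS; apply: hmax.
  rewrite INR_IZR_INZ Z2Nat.id; last lia.
  rewrite minus_IZR; lra.
apply/allpairsP; exists (f, Z.to_nat (c - floor (t * IZR f - 2 * r))).
by split => //; rewrite [RHS]/=; lia.
Qed.

(** Polarisation. The differences [x - x'] and [y - y'] are written through the sums because the
    sums are constant on the fibres where the relation is used. *)
Lemma qf_relation p1 p2 p3 (x y x' y' : Z) N :
  Rabs (qf p1 p2 p3 (IZR x) (IZR y) - qf p1 p2 p3 (IZR x') (IZR y')) < N ->
  Rabs ((2 * IZR x - IZR (x + x')) * IZR (lin (2 * p1) p2 (x + x') (y + y')) +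
        (2 * IZR y - IZR (y + y')) * IZR (lin p2 (2 * p3) (x + x') (y + y'))) < 2 * N.
Proof.
move=> h.
have -> : (2 * IZR x - IZR (x + x')) * IZR (lin (2 * p1) p2 (x + x') (y + y')) +
        (2 * IZR y - IZR (y + y')) * IZR (lin p2 (2 * p3) (x + x') (y + y')) =
     2 * (qf p1 p2 p3 (IZR x) (IZR y) - qf p1 p2 p3 (IZR x') (IZR y')).
  by rewrite /qf /lin !plus_IZR !mult_IZR !plus_IZR; ring.
rewrite Rabs_mult (Rabs_pos_eq 2); lra.
Qed.

Definition ratc (p1 p2 p3 : Z) (K rho : R) : R :=
  32 * K ^ 2 * (formc K 1 (2 * p1) p2 * K ^ 2) * (formc K 1 p2 (2 * p3) * K ^ 2) * (/ rho + 1).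

(* Pairs [(w, w')] with many representations: the relation of [qf_relation] says
   that [x + (w' / w) y] is nearly constant on the fibre, so that dilation by
   [w' / w] sends a large part of [A] into a translate of [- A]. *)
Lemma many_good_ratios (A V : seq Z) (p1 p2 p3 : Z) (s N C K rho : R) :
  (p2 * p2 - 4 * p1 * p3 <> 0)%Z ->
  approximate A K -> 1 <= K -> INR (size (sums A A)) <= K * INR (size A) ->
  0 < s < 1 -> 0 < N -> 0 < rho -> 1 <= 2 * rho * N ->
  frostman s N C (INR (size A)) A -> 0 <= C -> C * Rpower (2 * rho) s <= / 2 ->
  uniq V -> INR (size V) <= K * INR (size A) ->
  (forall x y, x \in A -> y \in A -> floor (qf p1 p2 p3 (IZR x) (IZR y) / N) \in V) ->
  exists (w : Z) (T : seq Z), [/\ uniq T,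
    form_values A (2 * p1) p2 (IZR w) /\ 2 * rho * N <= Rabs (IZR w),
    forall k, k \in T -> form_values A p2 (2 * p3) (IZR k),
    INR (size A) <= ratc p1 p2 p3 K rho * INR (size T) &
    forall k, k \in T -> covered A (ratc p1 p2 p3 K rho * (2 * / rho + 2))
      (fun z => exists2 a, a \in A & z = IZR k / IZR w * IZR a)].
Proof.
move=> disc apA K1 AA s01 N0 r0 rN fr C0 Cr uV sV AV.
have [uA A0 _ _] := apA.
have nA : 0 < INR (size A) by apply: INR_size_gt0; case: (A) A0.
have ir0 : 0 < / rho by apply: Rinv_0_lt_compat.
have Ku0 : 0 < K by lra.
(* The nonzero discriminant prevents both coefficients of the first partial derivative from
   vanishing. *)
have [sg [P [sgP uP PA sP]]] :=
  @large_linear_form A s N C rho (2 * p1) p2 uA s01 N0 r0 rN fr C0 Cr ltac:(lia).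
set u := formc K 1 (2 * p1) p2 * K ^ 2; set u' := formc K 1 p2 (2 * p3) * K ^ 2.
have K2 := pow_R1_Rle K 2 K1.
have u1 : 1 <= u by have := formc_ge1 (2 * p1) p2 K1 (Rle_refl 1); rewrite /u; nra.
have u1' : 1 <= u' by have := formc_ge1 p2 (2 * p3) K1 (Rle_refl 1); rewrite /u'; nra.
have Ku : 0 < 16 * K * u by apply: Rmult_lt_0_compat; lra.
pose fl (p : Z * Z) := floor (qf p1 p2 p3 (IZR p.1) (IZR p.2) / N).
pose S := [seq pq <- [seq (p, q) | p <- P, q <- P] | fl pq.1 == fl pq.2].
pose w (q : (Z * Z) * (Z * Z)) := lin (2 * p1) p2 (q.1.1 + q.2.1) (q.1.2 + q.2.2).
pose w' (q : (Z * Z) * (Z * Z)) := lin p2 (2 * p3) (q.1.1 + q.2.1) (q.1.2 + q.2.2).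
have uS : uniq S.
  by apply: filter_uniq; apply: allpairs_uniq => // -[? ?] [? ?].
have memS q : q \in S -> [/\ q.1 \in P, q.2 \in P & fl q.1 = fl q.2].
  by rewrite mem_filter => /andP[/eqP h /allpairsP[[p p'] [/= pP pP' e]]]; move: h; rewrite e.
(* Cauchy-Schwarz with at most [K * n] values on at least [n ^ 2 / 4] pairs, where [n] is the size
   of [A]. *)
have sS : INR (size A) ^ 3 <= 16 * K * INR (size S).
  have h1 : (size P ^ 2 <= size V * size S)%N.
    rewrite /S (pair_count (fun p q => fl p == fl q)).
    by apply: size_sqr_le_collisions => // p /PA[h1 h2 _]; exact: AV.
  have h2 : INR (size P) ^ 2 <= K * INR (size A) * INR (size S).
    move: (INR_leq h1); rewrite INR_muln expnS expn1 INR_muln => h2.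
    by apply: Rle_trans (Rmult_le_compat_r _ _ _ (pos_INR (size S)) sV); lra.
  have h3 : INR (size A) ^ 2 * INR (size A) ^ 2 <= 16 * INR (size P) ^ 2.
    have h0 := pow2_ge_0 (INR (size A)).
    by have := Rmult_le_compat _ _ _ _ h0 h0 sP sP; lra.
  by apply: (Rmult_le_reg_l (INR (size A))) => //; lra.
have S0 : S != [::].
  by apply/negP => /eqP e; move: sS; rewrite e /=; have := pow_lt _ 3 nA; rewrite /=; lra.
have [w0 w0U sS0] : exists2 i, i \in undup (map w S) &
    (size S <= size (undup (map w S)) * count (fun q => w q == i) S)%N.
  apply: (@pigeonhole _ _ w) => //; first exact: undup_uniq.
  by move=> q qS; rewrite mem_undup map_f.
have wS : forall q, q \in S -> form_values A (2 * p1) p2 (IZR (w q)).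
  move=> q /memS[/PA[h1 h2 _] /PA[h3 h4 _] _].
  by exists q.1.1, q.2.1, q.1.2, q.2.2.
have wS' : forall q, q \in S -> form_values A p2 (2 * p3) (IZR (w' q)).
  move=> q /memS[/PA[h1 h2 _] /PA[h3 h4 _] _].
  by exists q.1.1, q.2.1, q.1.2, q.2.2.
have sU : INR (size (undup (map w S))) <= u * INR (size A).
  apply: form_values_count => //; first exact: undup_uniq.
  by move=> z; rewrite mem_undup => /mapP[q /wS h ->].
have [q0 q0S w0E] : exists2 q, q \in S & w q = w0.
  by move: w0U; rewrite mem_undup => /mapP[q qS ->]; exists q.
(* On both pairs the linear form has the sign [sg] and size at least [rho * N], so nothing cancels
   in their sum. *)
have w0N : 2 * rho * N <= Rabs (IZR w0).
  have [/PA[_ _ h1] /PA[_ _ h2] _] := memS _ q0S.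
  rewrite -w0E /w.
  have -> : lin (2 * p1) p2 (q0.1.1 + q0.2.1) (q0.1.2 + q0.2.2) =
     (lin (2 * p1) p2 q0.1.1 q0.1.2 + lin (2 * p1) p2 q0.2.1 q0.2.2)%Z.
    by rewrite /lin; ring.
  move: h1 h2; rewrite !mult_IZR plus_IZR => h1 h2.
  have hs : IZR sg = 1 \/ IZR sg = - 1 by case: sgP => ->; [left|right].
  by rewrite /Rabs; case: Rcase_abs; case: hs h1 h2 => ->; nra.
have w0n0 : IZR w0 <> 0.
  have : 0 < 2 * rho * N by nra.
  by move=> h0 e; move: w0N; rewrite e Rabs_R0; lra.
pose S0' := [seq q <- S | w q == w0].
have uS0 : uniq S0' by exact: filter_uniq.
have memS0 q : q \in S0' -> w q = w0 /\ q \in S.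
  by rewrite mem_filter => /andP[/eqP].
have sS0' : INR (size A) ^ 2 <= 16 * K * u * INR (size S0').
  move: sS0; rewrite -size_filter -/S0' => /INR_leq; rewrite INR_muln => h1.
  have h2 := Rmult_le_compat_r _ _ _ (pos_INR (size S0')) sU.
  have h3 : INR (size S) <= u * INR (size A) * INR (size S0') by lra.
  have h4 := Rmult_le_compat_l (16 * K) _ _ ltac:(lra) h3.
  by apply: (Rmult_le_reg_l (INR (size A))) => //; lra.
have [h [hle hmax]] := @nat_floor (/ rho + 1) ltac:(lra).
pose fib k := [seq q <- S0' | w' q == k].
have ufib k : uniq (fib k) by exact: filter_uniq.
have memfib k q : q \in fib k -> [/\ w q = w0, w' q = k & q \in S].
  by rewrite mem_filter => /andP[/eqP<- /memS0[]].
(* The two pairs have sums that solve a linear system whose right side is [(w0, k)] and whose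
   determinant is, up to sign, the discriminant. *)
have same k q r : q \in fib k -> r \in fib k ->
    (q.1.1 + q.2.1 = r.1.1 + r.2.1 /\ q.1.2 + q.2.2 = r.1.2 + r.2.2)%Z.
  move=> /memfib[w1 w2 _] /memfib[w3 w4 _].
  move: w1 w2 w3 w4; rewrite /w /w' /lin.
  move: (q.1.1 + q.2.1)%Z (q.1.2 + q.2.2)%Z (r.1.1 + r.2.1)%Z (r.1.2 + r.2.2)%Z => a b c d e1 e2 e3 e4.
  have d1 : ((p2 * p2 - 4 * p1 * p3) * (b - d) = 0)%Z.
    have -> : ((p2 * p2 - 4 * p1 * p3) * (b - d) =
      p2 * (2 * p1 * a + p2 * b) - 2 * p1 * (p2 * a + 2 * p3 * b) -
      (p2 * (2 * p1 * c + p2 * d) - 2 * p1 * (p2 * c + 2 * p3 * d)))%Z by ring.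
    by rewrite e1 e2 e3 e4; ring.
  have d2 : ((p2 * p2 - 4 * p1 * p3) * (a - c) = 0)%Z.
    have -> : ((p2 * p2 - 4 * p1 * p3) * (a - c) =
      p2 * (p2 * a + 2 * p3 * b) - 2 * p3 * (2 * p1 * a + p2 * b) -
      (p2 * (p2 * c + 2 * p3 * d) - 2 * p3 * (2 * p1 * c + p2 * d)))%Z by ring.
    by rewrite e1 e2 e3 e4; ring.
  move: d1 d2 => /Z.mul_eq_0 [//|d1] /Z.mul_eq_0 [//|d2]; move: d1 d2; clear; lia.
(* With [z] the quantity to bound, the relation reads [|2 * z * w0| < 2 * N], and
   [|w0| >= 2 * rho * N]. *)
have line k : exists e, forall q, q \in fib k ->
    Rabs (IZR q.1.1 + IZR k / IZR w0 * IZR q.1.2 - e) <= / (2 * rho).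
  case: (fib k =P [::]) => [->|]; first by exists 0.
  case E : (fib k) => [//|r t] _; have rf : r \in fib k by rewrite E mem_head.
  exists ((IZR (r.1.1 + r.2.1) * IZR w0 + IZR (r.1.2 + r.2.2) * IZR k) / (2 * IZR w0)).
  rewrite -E => q qF; have [<- <-] := same _ _ _ qF rf.
  have [wq wq' /memS[_ _ flq]] := memfib _ _ qF.
  have dq : Rabs (qf p1 p2 p3 (IZR q.1.1) (IZR q.1.2) - qf p1 p2 p3 (IZR q.2.1) (IZR q.2.2)) < N.
    exact: floor_div_inj flq.
  have := qf_relation dq; rewrite -/(w q) -/(w' q) wq wq' => rel.
  set z := (X in Rabs X <= _).
  have ez : (2 * IZR q.1.1 - IZR (q.1.1 + q.2.1)) * IZR w0 +
    (2 * IZR q.1.2 - IZR (q.1.2 + q.2.2)) * IZR k = 2 * z * IZR w0.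
    by rewrite /z; field.
  move: rel; rewrite ez !Rabs_mult (Rabs_pos_eq 2); last lra.
  move=> rel; have zp := Rabs_pos z.
  apply: (Rmult_le_reg_r (2 * rho * N)); first nra.
  have -> : / (2 * rho) * (2 * rho * N) = N by field; lra.
  have := Rmult_le_compat_l _ _ _ zp w0N; lra.
(* As the sums are fixed, an element of the fibre is determined by its first pair; once [y] is
   given, [x] is an integer in an interval of length [/ rho]. *)
have fibsize k : (size (fib k) <= size (undup [seq q.1.2 | q <- fib k]) * h)%N.
  apply: (@size_le_fibers _ _ (fun q : (Z * Z) * (Z * Z) => q.1.2)); first exact: undup_uniq.
    by move=> q qF; rewrite mem_undup; apply/mapP; exists q.
  move=> y _; rewrite -size_filter -(size_map (fun q : (Z * Z) * (Z * Z) => q.1.1)).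
  have [e le] := line k.
  apply: hmax; apply: (@size_ints_le _ (e - IZR k / IZR w0 * IZR y - / (2 * rho))); first lra.
    rewrite map_inj_in_uniq; first by apply: filter_uniq.
    move=> [[x1 y1] [x1' y1']] [[x2 y2] [x2' y2']].
    rewrite mem_filter => /andP[/eqP /= -> f1]; rewrite mem_filter => /andP[/eqP /= -> f2] /= e0.
    have [/= e1 e2] : _ := same k _ _ f1 f2.
    by congr ((_, _), (_, _)); move: e0 e1 e2; clear; lia.
  move=> z /mapP[q]; rewrite mem_filter => /andP[/eqP qy qF] ->.
  have -> : / rho = 2 * / (2 * rho) by field; lra.
  by apply: Rabs_le_interval; rewrite -qy; exact: le.
have fibA k : {subset [seq q.1.2 | q <- fib k] <= A}.
  by move=> y /mapP[q /memfib[_ _ /memS[/PA[]]]] // _ ? _ _ _ ->.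
have fibmax k : (size (fib k) <= size A * h)%N.
  apply: leq_trans (fibsize k) _; rewrite leq_mul2r; apply/orP; right.
  by apply: uniq_leq_size; [exact: undup_uniq|move=> y; rewrite mem_undup; exact: fibA].
pose U := undup (map w' S0').
have uU : uniq U by exact: undup_uniq.
have sU' : INR (size U) <= u' * INR (size A).
  apply: form_values_count => //.
  by move=> z; rewrite mem_undup => /mapP[q /memS0[_ /wS' hq] ->].
have n2 := pow_lt _ 2 nA.
have s0 : 0 < INR (size S0').
  case: (Rle_lt_dec (INR (size S0')) 0) => // h0.
  have e : INR (size S0') = 0 by have := pos_INR (size S0'); lra.
  by move: sS0'; rewrite e; lra.
have un : 0 < 2 * u' * INR (size A) by nra.
(* Half of the average fibre size that [size U <= u' * n] guarantees. *)
have [t [tle tmax]] := @nat_floor (INR (size S0') / (2 * u' * INR (size A)))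
  ltac:(apply: Rlt_le; exact: Rdiv_lt_0_compat).
pose T := [seq k <- U | (t < size (fib k))%N].
have sT : INR (size A) <= 32 * K * u * (/ rho + 1) * INR (size T).
  have : (size S0' <= size U * t + size T * (size A * h))%N.
    have := popular_values (f := w') (S := S0') (h := (size A * h)%N) t uU.
    rewrite /T; under [in X in _ -> X]eq_filter => k do rewrite /fib size_filter.
    apply => [q qS|k kU]; first by rewrite mem_undup map_f.
    by rewrite -size_filter; exact: fibmax.
  move=> /INR_leq; rewrite INR_addn !INR_muln => h1.
  have h2 : INR (size U) * INR t <= INR (size S0') / 2.
    apply: Rle_trans (Rmult_le_compat _ _ _ _ (pos_INR _) (pos_INR _) sU' tle) _.
    by right; field; split; lra.
  have h3 : INR (size S0') <= 2 * INR (size T) * INR (size A) * (/ rho + 1).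
    have := Rmult_le_compat_l _ _ _ (Rmult_le_pos _ _ (pos_INR (size T)) (Rlt_le _ _ nA)) hle; lra.
  have h4 := Rmult_le_compat_l (16 * K * u) _ _ (Rlt_le _ _ Ku) h3.
  by apply: (Rmult_le_reg_l (INR (size A))) => //; lra.
have rr : 1 <= / rho + 1 by lra.
have ru : ratc p1 p2 p3 K rho = 32 * K ^ 2 * u * u' * (/ rho + 1) by [].
exists w0, T; split.
- exact: filter_uniq.
- by split => //; rewrite -w0E; exact: wS.
- by move=> k; rewrite mem_filter mem_undup => /andP[_ /mapP[q /memS0[_ /wS' hq] ->]].
- apply: Rle_trans sT _; rewrite ru; apply: Rmult_le_compat_r; first exact: pos_INR.
  apply: Rmult_le_compat_r; first lra.
  have : 1 <= K * u' by exact: Rmult_ge1.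
  have : 0 <= 32 * K * u by lra.
  move=> a b; have := Rmult_le_compat_l _ _ _ a b; lra.
- move=> k; rewrite mem_filter => /andP[/ltP tk _].
  have [e le] := line k.
  pose Y := undup [seq q.1.2 | q <- fib k].
  (* [t] is the largest integer below the threshold, so a fibre with more than [t] elements exceeds
     the threshold itself. *)
  have fibL : INR (size S0') <= 2 * u' * INR (size A) * INR (size (fib k)).
    case: (Rle_lt_dec (INR (size S0')) (2 * u' * INR (size A) * INR (size (fib k)))) => // lt.
    have : INR (size (fib k)) <= INR (size S0') / (2 * u' * INR (size A)).
      apply: (Rmult_le_reg_r (2 * u' * INR (size A))) => //.
      set d := 2 * u' * INR (size A) in un lt *.
      have -> : INR (size S0') / d * d = INR (size S0') by field; lra.
      by lra.
    by move=> /tmax; move: tk; clear; lia.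
  have YL : INR (size A) <= 32 * K * u * u' * (/ rho + 1) * INR (size Y).
    have h1 := INR_leq (fibsize k); rewrite INR_muln -/Y in h1.
    have h2 := Rmult_le_compat_l _ _ _ (pos_INR (size Y)) hle.
    have h3 : INR (size (fib k)) <= INR (size Y) * (/ rho + 1) by lra.
    have h4 := Rmult_le_compat_l _ _ _ (Rlt_le _ _ un) h3.
    have h5 : INR (size S0') <= 2 * u' * INR (size A) * (INR (size Y) * (/ rho + 1)) by lra.
    have h6 := Rmult_le_compat_l (16 * K * u) _ _ (Rlt_le _ _ Ku) h5.
    by apply: (Rmult_le_reg_l (INR (size A))) => //; lra.
  apply: covered_sub (@covered_dilate A Y K _ (IZR k / IZR w0) e (/ (2 * rho)) apA AA _ _ _ _ YL _) => //.
  + rewrite ru; right; field; lra.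
  + exact: undup_uniq.
  + by apply: Rlt_le; apply: Rinv_0_lt_compat; lra.
  + have h1 : 0 < 32 * K * u by lra.
    have h2 : 0 < u' * (/ rho + 1) by apply: Rmult_lt_0_compat; lra.
    by have := Rmult_lt_0_compat _ _ h1 h2; lra.
  + by move=> y; rewrite mem_undup; exact: fibA.
  + move=> y; rewrite mem_undup => /mapP[q qF ->]; exists q.1.1; last exact: le.
    by have [_ _ /memS[/PA[]]] := memfib _ _ qF.
Qed.

(** * Quotients of differences *)

Definition Rltb (x y : R) : bool := if Rlt_dec x y then true else false.

Lemma RltbP x y : reflect (x < y) (Rltb x y).
Proof. by rewrite /Rltb; case: Rlt_dec => h; constructor. Qed.

Lemma sum_le_const (T : eqType) (S : seq T) (F : T -> nat) (h : nat) :
  {in S, forall x, F x <= h}%N -> (\sum_(x <- S) F x <= size S * h)%N.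
Proof.
move=> Fh; rewrite big_seq; apply: leq_trans (_ : \sum_(i <- S | i \in S) h <= _)%N; first exact: leq_sum.
by rewrite -big_seq big_const_seq count_predT iter_addn_0 mulnC.
Qed.

Lemma sum_ge_constR (T : eqType) (S : seq T) (F : T -> nat) (x : R) :
  {in S, forall j, x <= INR (F j)} -> INR (size S) * x <= INR (\sum_(j <- S) F j).
Proof.
elim: S => [|j S IH] Fx; first by rewrite big_nil /=; lra.
have h1 := Fx j (mem_head _ _).
have h2 : INR (size S) * x <= INR (\sum_(i <- S) F i).
  by apply: IH => i iS; apply: Fx; rewrite inE iS orbT.
rewrite big_cons INR_addn [size _]/= S_INR; lra.
Qed.

Lemma sum_le_constR (T : eqType) (S : seq T) (F : T -> nat) (x : R) :
  {in S, forall j, INR (F j) <= x} -> INR (\sum_(j <- S) F j) <= INR (size S) * x.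
Proof.
elim: S => [|j S IH] Fx; first by rewrite big_nil /=; lra.
have h1 := Fx j (mem_head _ _).
have h2 : INR (\sum_(i <- S) F i) <= INR (size S) * x.
  by apply: IH => i iS; apply: Fx; rewrite inE iS orbT.
rewrite big_cons INR_addn [size _]/= S_INR; lra.
Qed.

(** [p] and [q] have nearly the same image under [(u, v) |-> u + y * v]. *)
Definition close (g y : R) (p q : Z * Z) : bool :=
  Rltb (Rabs (IZR (p.1 - q.1) + y * IZR (p.2 - q.2))) g.

Section CloseCount.

Variables (T : seq Z) (s N m1 n : R).
Hypothesis uT : uniq T.
Hypothesis frT : frostman s N m1 n T.
Hypothesis N0 : 0 < N.
Hypothesis m1n : 0 <= m1 * n.

Let TT := [seq (u, v) | u <- T, v <- T].

Lemma ball_count l : 1 <= 2 * l -> exists h, INR h <= m1 * Rpower (2 * l / N) s * n /\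
  forall x (P : pred Z), (forall z, P z -> Rabs (IZR z - x) <= l) -> (count P T <= h)%N.
Proof.
move=> l1; have p0 := Rpower_gt0 (2 * l / N) s.
have [|h [hle hmax]] := @nat_floor (m1 * Rpower (2 * l / N) s * n).
  by have := Rmult_le_pos _ _ m1n (Rlt_le _ _ p0); lra.
exists h; split => // x P hP; rewrite -size_filter; apply: hmax.
apply: (frT (x := x - l)) => //; first exact: filter_uniq.
  by apply: mem_subseq; exact: filter_subseq.
move=> z; rewrite mem_filter => /andP[/hP + _].
by rewrite /Rabs; case: Rcase_abs; lra.
Qed.

(** [p] is free; then [q.2] lies in a ball of radius [k] about [p.2], and [q.1] in a ball of radius
    [g] about a point that [p] and [q.2] determine. *)
Lemma close_count y g k : 1 <= 2 * g -> 1 <= 2 * k ->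
  INR (\sum_(p <- TT) \sum_(q <- TT) (Rltb (Rabs (IZR (p.2 - q.2))) k && close g y p q : nat)) <=
  INR (size T) ^ 2 * (m1 * Rpower (2 * k / N) s * n) * (m1 * Rpower (2 * g / N) s * n).
Proof.
move=> g1 k1.
have [h1 [h1le h1max]] := ball_count k1.
have [h2 [h2le h2max]] := ball_count g1.
have key : (\sum_(p <- TT) \sum_(q <- TT) (Rltb (Rabs (IZR (p.2 - q.2))) k && close g y p q : nat) <=
    size T * size T * (h1 * h2))%N.
  rewrite -[X in (_ <= X * _)%N](size_allpairs (fun u v : Z => (u, v))).
  apply: sum_le_const => -[u v] _; rewrite /TT big_allpairs exchange_big /=.
  apply: leq_trans (_ : \sum_(v' <- T) Rltb (Rabs (IZR (v - v'))) k * h2 <= _)%N.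
    apply: leq_sum => v' _; case: Rltb; last by rewrite big1.
    rewrite mul1n /= -count_sum; apply: (h2max (IZR u + y * IZR (v - v'))) => u'.
    move=> /RltbP /=; rewrite minus_IZR /Rabs; do 2 case: Rcase_abs; lra.
  rewrite -big_distrl /= leq_mul2r -count_sum; apply/orP; right.
  apply: (h1max (IZR v)) => v' /RltbP.
  rewrite minus_IZR /Rabs; do 2 case: Rcase_abs; lra.
apply: Rle_trans (INR_leq key) _; rewrite !INR_muln.
have := Rmult_le_compat _ _ _ _ (pos_INR _) (pos_INR _) h1le h2le => h.
have := Rmult_le_compat_l _ _ _ (pow2_ge_0 (INR (size T))) h; lra.
Qed.

End CloseCount.

Section Quotients.

Variables (T : seq Z) (s N n c rho m0 m1 w : R).
Hypothesis uT : uniq T.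
Hypothesis s01 : 0 < s < 1.
Hypothesis N1 : 1 <= N.
Hypothesis n0 : 0 < n.
Hypothesis nN : n <= 2 * Rpower N s.
Hypothesis c1 : 1 <= c.
Hypothesis rho01 : 0 < rho <= 1.
Hypothesis m01 : 1 <= m0.
Hypothesis m11 : 1 <= m1.
Hypothesis wN : rho * N <= Rabs w <= c * N.
Hypothesis TN : forall t, t \in T -> Rabs (IZR t) <= c * N.
Hypothesis nT : n <= m0 * INR (size T).
Hypothesis frT : frostman s N m1 n T.

(** With [x = (a - b) / (d - e)] this is [al * (d - e) / w] times [u + (x + be) / al * v]: [al = 2]
    serves the halving of quotients, [al = 1] the quotient itself. Every term is a product of two
    elements of [T] over [w]. *)
Definition quotient_form (al be a b d e : Z) (p : Z * Z) : R :=
  (IZR (al * (d - e)) * IZR p.1 + IZR (a - b + be * (d - e)) * IZR p.2) / w.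

Hypothesis frH : forall al be a b d e, (1 <= al <= 2)%Z -> (0 <= be <= 1)%Z ->
  a \in T -> b \in T -> d \in T -> e \in T ->
  forall l, 1 <= l ->
  (forall u v, u \in T -> v \in T -> Rabs (quotient_form al be a b d e (u, v)) <= l / 2) ->
  forall zs, uniq zs ->
  (forall z, z \in zs -> exists u v,
    [/\ u \in T, v \in T & z = floor (quotient_form al be a b d e (u, v))]) ->
  INR (size zs) <= m1 * Rpower (l / N) s * n.

Let TT := [seq (u, v) | u <- T, v <- T].

Let w0 : 0 < Rabs w.
Proof. have h : 0 < rho * N by apply: Rmult_lt_0_compat; lra. lra. Qed.

Let memTT p : p \in TT -> p.1 \in T /\ p.2 \in T.
Proof. by case/allpairsP=> -[u v] [/= uT' vT' ->]. Qed.

Let w_neq0 : w <> 0.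
Proof. by move=> e; move: w0; rewrite e Rabs_R0; lra. Qed.

Let m1n0 : 0 <= m1 * n. Proof. apply: Rmult_le_pos; lra. Qed.

(** Put [D = |d - e|]. The image lies in an interval of length [16 * c * D / rho], so [frH] makes it
    small and Cauchy-Schwarz gives collisions. Equal integer parts force [u + y * v] to agree within
    [|w| / (al * D) <= c * N / D]. *)
Lemma collisions_lower_bound al be a b d e y :
  (1 <= al <= 2)%Z -> (0 <= be <= 1)%Z ->
  a \in T -> b \in T -> d \in T -> e \in T -> (d <> e)%Z ->
  y * IZR (al * (d - e)) = IZR (a - b + be * (d - e)) -> Rabs y <= 3 ->
  INR (size T) ^ 4 <= m1 * Rpower (16 * c * Rabs (IZR (d - e)) / rho / N) s * n *
    INR (\sum_(p <- TT) \sum_(q <- TT) (close (c * N / Rabs (IZR (d - e))) y p q : nat)).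
Proof.
move=> al12 be01 aT bT dT eT de ye y3.
set D := Rabs (IZR (d - e)).
have D1 : 1 <= D by rewrite /D -abs_IZR; apply: IZR_le; lia.
have al1 : 1 <= IZR al <= 2 by split; apply: IZR_le; lia.
set h := quotient_form al be a b d e.
have hE p : h p = IZR al * IZR (d - e) * (IZR p.1 + y * IZR p.2) / w.
  by rewrite /h /quotient_form -ye mult_IZR; field.
have hb u v : u \in T -> v \in T -> Rabs (h (u, v)) <= 16 * c * D / rho / 2.
  move=> /TN uN /TN vN; rewrite hE /= Rabs_mult Rabs_inv !Rabs_mult (Rabs_pos_eq (IZR al)) -/D; last lra.
  have h1 : Rabs (IZR u + y * IZR v) <= 4 * (c * N).
    apply: Rle_trans (Rabs_triang _ _) _; rewrite Rabs_mult.
    have := Rmult_le_compat _ _ _ _ (Rabs_pos _) (Rabs_pos _) y3 vN; lra.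
  apply: (Rmult_le_reg_r (Rabs w)) => //; rewrite Rmult_assoc Rinv_l; last lra.
  rewrite Rmult_1_r.
  apply: Rle_trans (_ : 2 * D * (4 * (c * N)) <= _).
    apply: Rmult_le_compat => //; [nra|exact: Rabs_pos|nra].
  have -> : 2 * D * (4 * (c * N)) = 16 * c * D / rho / 2 * (rho * N) by field; repeat split; lra.
  apply: Rmult_le_compat_l; last lra.
  have := Rinv_0_lt_compat _ (proj1 rho01) => ir.
  by have : 0 < c * D * / rho; [apply: Rmult_lt_0_compat; nra|rewrite /Rdiv; lra].
pose U := undup [seq floor (h p) | p <- TT].
have sU : INR (size U) <= m1 * Rpower (16 * c * D / rho / N) s * n.
  apply: (frH al12 be01 aT bT dT eT) => //; last 1 first.
  - move=> z; rewrite mem_undup => /mapP[_ /allpairsP[[u v] [/= uT' vT' ->]] ->].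
    by exists u, v.
  - have -> : 16 * c * D / rho = 16 * c * D * / rho by [].
    have : 1 <= / rho by rewrite -Rinv_1; apply: Rinv_le_contravar; lra.
    have h1 : 1 <= 16 * c * D by nra.
    by move=> ir; rewrite -[1]Rmult_1_l; apply: Rmult_le_compat; lra.
  - exact: undup_uniq.
have cs : (size TT ^ 2 <= size U * \sum_(p <- TT) \sum_(q <- TT) (floor (h p) == floor (h q) : nat))%N.
  by apply: size_sqr_le_collisions; [exact: undup_uniq|move=> p pT; rewrite mem_undup map_f].
have le : (\sum_(p <- TT) \sum_(q <- TT) (floor (h p) == floor (h q) : nat) <=
   \sum_(p <- TT) \sum_(q <- TT) (close (c * N / D) y p q : nat))%N.
  apply: leq_sum => p _; apply: leq_sum => q _; case: eqP => // e1.
  suff -> : close (c * N / D) y p q by [].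
  apply/RltbP; set z := IZR _ + _.
  have ez : h p - h q = IZR al * IZR (d - e) * z / w.
    by rewrite !hE /z !minus_IZR; field.
  have hp := floor_spec (h p); have hq := floor_spec (h q); rewrite -e1 in hq.
  have : Rabs (h p - h q) < 1 by rewrite /Rabs; case: Rcase_abs; lra.
  rewrite ez Rabs_mult Rabs_inv !Rabs_mult (Rabs_pos_eq (IZR al)) -/D; last lra.
  move=> lt; apply: (Rmult_lt_reg_l D); first lra.
  have -> : D * (c * N / D) = c * N by field; repeat split; lra.
  apply: Rlt_le_trans (proj2 wN).
  apply: Rle_lt_trans (_ : IZR al * D * Rabs z < _).
    have := Rmult_le_pos _ _ (Rle_trans _ _ _ Rle_0_1 D1) (Rabs_pos z); nra.
  apply: (Rmult_lt_reg_r (/ Rabs w)); first exact: Rinv_0_lt_compat.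
  by rewrite Rinv_r; lra.
have := INR_leq (leq_trans cs (leq_mul (leqnn _) le)).
rewrite size_allpairs expnS expn1 !INR_muln => h1.
apply: Rle_trans (_ : INR (size U) * _ <= _); last first.
  by apply: Rmult_le_compat_r sU; exact: pos_INR.
apply: Rle_trans h1; right; ring.
Qed.

Definition quotient (r x : R) : Prop := exists a b d e,
  [/\ a \in T, b \in T, d \in T, e \in T & r * N <= Rabs (IZR (d - e)) /\ x * IZR (d - e) = IZR (a - b)].

Variable r : R.
Hypothesis r01 : 0 < r <= 1.
Hypothesis rN : 1 <= r * N.
Hypothesis rsmall : 2 * m0 ^ 2 * m1 ^ 3 * Rpower (64 * c ^ 2 * r / rho) s < 1.
Let eta := c / (r ^ 2 * N).
Hypothesis eta1 : 3 * eta <= 1.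

Let nonzero_diff d e : r * N <= Rabs (IZR (d - e)) -> d <> e.
Proof.
move=> h E; move: h; rewrite E Z.sub_diag Rabs_R0; lra.
Qed.

Let mT : 0 < INR (size T).
Proof. by case: (Rle_lt_dec (INR (size T)) 0) => // h; nra. Qed.

Let Rpower_N : Rpower N s * Rpower (/ N) s = 1.
Proof.
rewrite Rpower_mult_distr; [|lra|apply: Rinv_0_lt_compat; lra].
by rewrite Rinv_r ?Rpower_1_base // /Rpower ?ln_1 ?Rmult_0_r ?exp_0 //; lra.
Qed.

Let n_N : n * Rpower (/ N) s <= 2.
Proof.
have := Rmult_le_compat_r _ _ _ (Rlt_le _ _ (Rpower_gt0 (/ N) s)) nN.
by rewrite Rmult_assoc Rpower_N; lra.
Qed.

(** Two colliding pairs with [|v - v'| >= r * N] yield the quotient [(u' - u) / (v - v')], within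
    [c * N / (D * r * N) <= eta] of [y]. If there is none, all collisions have [|v - v'| < r * N],
    and these are too few by [rsmall]. *)
Lemma quotient_halve x be : (0 <= be <= 1)%Z -> Rabs x <= 4 -> quotient r x ->
  exists2 x', quotient r x' & Rabs (x' - (x + IZR be) / 2) <= eta.
Proof.
move=> be01 x4 [a [b [d [e [aT bT dT eT [deN xde]]]]]].
apply: NNPP => no.
set y := (x + IZR be) / 2 in no.
have be1 : 0 <= IZR be <= 1 by split; apply: IZR_le; lia.
have y3 : Rabs y <= 3.
  by move: x4; rewrite /y /Rabs; do 2 case: Rcase_abs; lra.
have de := nonzero_diff deN.
have ye : y * IZR (2 * (d - e)) = IZR (a - b + be * (d - e)).
  by rewrite plus_IZR -xde !mult_IZR /y; field.
have := collisions_lower_bound (al := 2) _ be01 aT bT dT eT de ye y3.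
set D := Rabs (IZR (d - e)) in deN *; set g := c * N / D.
have D0 : 0 < D by lra.
have DN : D <= 2 * (c * N).
  have h1 := TN dT; have h2 := TN eT.
  rewrite /D minus_IZR; apply: Rle_trans (Rabs_triang _ _) _; rewrite Rabs_Ropp; lra.
have gN : g <= c / r.
  rewrite /g; apply: (Rmult_le_reg_r (D * r)); first nra.
  have -> : c * N / D * (D * r) = c * (r * N) by field; repeat split; lra.
  have -> : c / r * (D * r) = c * D by field; repeat split; lra.
  nra.
have g1 : 1 <= 2 * g.
  rewrite /g; apply: (Rmult_le_reg_r D) => //.
  have -> : 2 * (c * N / D) * D = 2 * (c * N) by field; repeat split; lra.
  lra.
have sub : (\sum_(p <- TT) \sum_(q <- TT) (close g y p q : nat) <=
  \sum_(p <- TT) \sum_(q <- TT) (Rltb (Rabs (IZR (p.2 - q.2))) (r * N) && close g y p q : nat))%N.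
  rewrite big_seq [leqRHS]big_seq; apply: leq_sum => p /memTT[p1 p2].
  rewrite big_seq [leqRHS]big_seq; apply: leq_sum => q /memTT[q1 q2].
  case: RltbP => //= /Rnot_lt_le far; rewrite /close; case: RltbP => // cl; exfalso; apply: no.
  have V0 : IZR (p.2 - q.2) <> 0 by move=> E; move: far; rewrite E Rabs_R0; lra.
  exists (IZR (q.1 - p.1) / IZR (p.2 - q.2)).
    by exists q.1, p.1, p.2, q.2; split => //; split => //; field.
  set z := (X in Rabs X <= _).
  have zE : IZR (p.1 - q.1) + y * IZR (p.2 - q.2) = - z * IZR (p.2 - q.2).
    by rewrite /z !minus_IZR; field; move: V0; rewrite minus_IZR.
  move: cl; rewrite zE Rabs_mult Rabs_Ropp => cl.
  apply: (Rmult_le_reg_r (r * N)); first lra.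
  have -> : eta * (r * N) = c / r by rewrite /eta; field; repeat split; lra.
  apply: Rle_trans (Rmult_le_compat_l _ _ _ (Rabs_pos z) far) _.
  by apply: Rle_trans gN; exact: Rlt_le.
have k1 : 1 <= 2 * (r * N) by lra.
have cc := close_count uT frT m1n0 y g1 k1.
have {}cc := Rle_trans _ _ _ (INR_leq sub) cc.
move=> /(_ ltac:(lia)); set R1 := Rpower (_ / N) s => lb.
set R2 := Rpower _ s in cc; set R3 := Rpower _ s in cc.
have RE : R1 * R2 * R3 = Rpower (64 * c ^ 2 * r / rho) s * Rpower (/ N) s.
  have i0 := Rinv_0_lt_compat _ (proj1 rho01).
  have iN : 0 < / N by apply: Rinv_0_lt_compat; lra.
  have iD : 0 < / D by apply: Rinv_0_lt_compat.
  have cD : 0 < 16 * c * D by apply: Rmult_lt_0_compat; lra.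
  have pos : 0 < 64 * c ^ 2 * r / rho.
    apply: Rdiv_lt_0_compat; last lra.
    by apply: Rmult_lt_0_compat; last lra; have := pow_R1_Rle c 2 c1; lra.
  have p1 : 0 < 16 * c * D / rho / N by apply: Rdiv_lt_0_compat; [apply: Rdiv_lt_0_compat|]; lra.
  have p2 : 0 < 2 * (r * N) / N by apply: Rdiv_lt_0_compat; lra.
  have p3 : 0 < 2 * g / N by apply: Rdiv_lt_0_compat; lra.
  rewrite /R1 /R2 /R3 Rpower_mult_distr // Rpower_mult_distr //; last exact: Rmult_lt_0_compat.
  by rewrite Rpower_mult_distr //; congr (Rpower _ s); rewrite /g; field; repeat split; lra.
have mT' := mT; have nT' := nT; have rs := rsmall.
set m := INR (size T) in lb cc mT' nT' *.
have R1p := Rpower_gt0 (16 * c * D / rho / N) s; rewrite -/R1 in R1p.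
have p0 : 0 <= m1 * R1 * n by apply: Rmult_le_pos; [apply: Rmult_le_pos|]; lra.
have := Rle_trans _ _ _ lb (Rmult_le_compat_l _ _ _ p0 cc).
have -> : m1 * R1 * n * (m ^ 2 * (m1 * R2 * n) * (m1 * R3 * n)) =
   m ^ 2 * (m1 ^ 3 * (n * n) * n * (R1 * R2 * R3)) by ring.
rewrite RE; set R0 := Rpower (64 * _ * _ / _) s in rs *; set RN := Rpower (/ N) s => fin.
have R00 : 0 < R0 by exact: Rpower_gt0.
have fin2 : m ^ 2 <= m1 ^ 3 * (n * n) * R0 * 2.
  have m2 := pow_lt _ 2 mT'.
  apply: (Rmult_le_reg_l (m ^ 2)) => //.
  have h3 : 0 <= m ^ 2 * (m1 ^ 3 * (n * n) * R0).
    apply: Rmult_le_pos; first lra; apply: Rmult_le_pos; last lra.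
    by apply: Rmult_le_pos; [apply: pow_le; lra|apply: Rmult_le_pos; lra].
  have := Rmult_le_compat_l _ _ _ h3 n_N; rewrite -/RN; lra.
have nn : n * n <= m0 ^ 2 * m ^ 2.
  by have := Rmult_le_compat _ _ _ _ (Rlt_le _ _ n0) (Rlt_le _ _ n0) nT' nT'; lra.
have h4 : 0 <= m1 ^ 3 * R0 * 2.
  by apply: Rmult_le_pos; last lra; apply: Rmult_le_pos; [apply: pow_le|]; lra.
have h5 := Rmult_le_compat_l _ _ _ h4 nn.
have m2 := pow_lt _ 2 mT'.
have h6 := Rmult_lt_compat_r _ _ _ m2 rs.
lra.
Qed.

(** Prepending a binary digit halves the old error and adds [eta], so the error stays below
    [(/ 2) ^ k + 2 * eta]. The process starts from the quotient 0, which requires two points of [T]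
    at distance at least [r * N]. *)
Lemma quotient_dense y : 0 <= y <= 1 -> exists2 x, quotient r x & Rabs (x - y) <= 3 * eta.
Proof.
have eta0 : 0 < eta by apply: Rdiv_lt_0_compat; first lra; have := pow_lt r 2 ltac:(lra); nra.
have dyadic : forall (k : nat) y, 0 <= y <= 1 ->
    exists2 x, quotient r x & Rabs (x - y) <= (/ 2) ^ k + 2 * eta.
  elim=> [|k IH] {}y y01.
    have [t tT] : exists t, t \in T.
      by case: (T) mT => [|t T' _]; [rewrite /=; lra|exists t; rewrite mem_head].
    (* Otherwise [T] lies in an interval of length [2 * r * N], against the Frostman bound and
       [rsmall]. *)
    have [d dT far] : exists2 d, d \in T & r * N <= Rabs (IZR (d - t)).
      apply: NNPP => no.
      have h : INR (size T) <= m1 * Rpower (2 * r * N / N) s * n.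
        apply: (frT (x := IZR t - r * N)) => //; first nra.
        move=> z zT; have : Rabs (IZR (z - t)) < r * N.
          by apply: Rnot_le_lt => h; apply: no; exists z.
        by rewrite minus_IZR /Rabs; case: Rcase_abs; lra.
      have R1 : Rpower (2 * r * N / N) s <= Rpower (64 * c ^ 2 * r / rho) s.
        apply: Rpower_mono; first lra.
          by apply: Rdiv_lt_0_compat; nra.
        have -> : 2 * r * N / N = 2 * r by field; repeat split; lra.
        apply: (Rmult_le_reg_r rho); first lra.
        have -> : 64 * c ^ 2 * r / rho * rho = 64 * c ^ 2 * r by field; repeat split; lra.
        have := pow_R1_Rle c 2 c1; nra.
      have rs := rsmall; set R0 := Rpower (64 * c ^ 2 * r / rho) s in R1 rs.
      have R00 : 0 < R0 by exact: Rpower_gt0.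
      have h1 : INR (size T) <= m1 * R0 * n.
        apply: Rle_trans h _; apply: Rmult_le_compat_r; first lra.
        by apply: Rmult_le_compat_l; lra.
      have h2 : n <= m0 * m1 * R0 * n.
        by apply: Rle_trans nT _; have := Rmult_le_compat_l m0 _ _ ltac:(lra) h1; lra.
      have h3 : m0 * m1 * R0 < 1.
        apply: Rle_lt_trans rs.
        have e1 : m0 <= m0 ^ 2 by nra.
        have e2 : m1 <= m1 ^ 3.
          have -> : m1 ^ 3 = m1 * m1 ^ 2 by ring.
          rewrite -[X in X <= _]Rmult_1_r.
          by apply: Rmult_le_compat_l; [lra|exact: pow_R1_Rle].
        have e3 : m0 * m1 <= m0 ^ 2 * m1 ^ 3 by apply: Rmult_le_compat; lra.
        have := Rmult_le_compat_r R0 _ _ (Rlt_le _ _ R00) e3.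
        have : 0 <= m0 * m1 * R0 by apply: Rmult_le_pos; last lra; apply: Rmult_le_pos; lra.
        lra.
      nra.
    exists 0.
      by exists t, t, d, t; split => //; split => //; rewrite Z.sub_diag; lra.
    by rewrite /= /Rabs; case: Rcase_abs; lra.
  have [be [y' [be01 y'01 yE]]] :
      exists be y', [/\ (0 <= be <= 1)%Z, 0 <= y' <= 1 & y = (y' + IZR be) / 2].
    case: (Rle_lt_dec y (/ 2)) => h.
      by exists 0%Z, (2 * y); split; [lia|lra|lra].
    by exists 1%Z, (2 * y - 1); split; [lia|lra|lra].
  have [x Qx xy] := IH y' y'01.
  have k1 : (/ 2) ^ k <= 1.
    by rewrite -(pow1 k); apply: pow_incr; lra.
  have x4 : Rabs x <= 4.
    by move: xy; rewrite /Rabs; do 2 case: Rcase_abs; lra.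
  have [x' Qx' xx'] := quotient_halve be01 x4 Qx.
  exists x' => //; rewrite yE.
  have -> : x' - (y' + IZR be) / 2 = (x' - (x + IZR be) / 2) + (x - y') / 2 by field.
  apply: Rle_trans (Rabs_triang _ _) _.
  rewrite /Rdiv (Rabs_mult (x - y')) (Rabs_pos_eq (/ 2)) /=; lra.
move=> y01.
have [k hk] := pow_lt_1_zero (/ 2) ltac:(rewrite Rabs_pos_eq; lra) eta eta0.
have := hk k (le_n k); rewrite Rabs_pos_eq => [k2|]; last by apply: pow_le; lra.
have [x Qx xy] := dyadic k y y01; exists x => //; lra.
Qed.


(** The admissible dilations form an interval of length at most [2 * g / k], met by few points of a
    grid of mesh [/ INR J]. *)
Lemma few_dilations (J : nat) (g k : R) (p q : Z * Z) : 0 < g -> 0 < k -> (0 < J)%N ->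
  k <= Rabs (IZR (p.2 - q.2)) ->
  INR (count (fun j => close g (INR j / INR J) p q) (iota 0 J)) <= 2 * g * INR J / k + 1.
Proof.
move=> g0 k0 J0; set a := IZR (p.1 - q.1); set v := IZR (p.2 - q.2) => kv.
have J1 : 0 < INR J by apply: lt_0_INR; lia.
have v0 : v <> 0 by move=> E; move: kv; rewrite E Rabs_R0; lra.
have gk : 0 < g * INR J / k.
  by apply: Rdiv_lt_0_compat => //; exact: Rmult_lt_0_compat.
rewrite -size_filter -(size_map Z.of_nat).
apply: (@size_ints_le _ (- a * INR J / v - g * INR J / k)); first by rewrite /Rdiv in gk *; lra.
  rewrite map_inj_uniq; last by move=> x x' h; lia.
  exact: filter_uniq (iota_uniq _ _).
move=> z /mapP[j]; rewrite mem_filter => /andP[/RltbP cl _] ->.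
rewrite -INR_IZR_INZ.
have : Rabs (INR j - - a * INR J / v) <= g * INR J / k.
  have -> : INR j - - a * INR J / v = (a + INR j / INR J * v) * INR J / v.
    by field; repeat split; lra.
  rewrite /Rdiv !Rabs_mult Rabs_inv (Rabs_pos_eq (INR J)); last lra.
  have v1 : 0 < Rabs v by lra.
  apply: (Rmult_le_reg_r (Rabs v)) => //; rewrite Rmult_assoc Rinv_l ?Rmult_1_r; last lra.
  apply: Rle_trans (_ : g * INR J <= _).
    by apply: Rmult_le_compat_r; [lra|exact: Rlt_le].
  apply: (Rmult_le_reg_r k) => //.
  have -> : g * INR J * / k * Rabs v * k = g * INR J * Rabs v by field; repeat split; lra.
  by apply: Rmult_le_compat_l => //; apply: Rmult_le_pos; lra.
have -> : 2 * g * INR J / k = 2 * (g * INR J / k) by field; repeat split; lra.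
by rewrite /Rabs; case: Rcase_abs; lra.
Qed.

(** At every grid point [j / J] there are many collisions, since a quotient lies nearby. Summed over
    [j], those with [|v - v'| < r2 * N] are few by the Frostman bound, and any other pair collides
    for few [j]; by [small] and [large] each share is less than half of the total. *)
Lemma collisions_average r2 : 0 < r2 <= 1 -> 1 <= 2 * (r2 * N) ->
  4 * m0 ^ 2 * m1 ^ 3 * (32 * c ^ 2 / rho) * Rpower (28 * c ^ 2 * r2 / r ^ 2) s < 1 ->
  2 * (m1 * (32 * c ^ 2 / rho) * (15 * c ^ 2 / (r ^ 2 * r2)) * n) < N -> False.
Proof.
move=> r201 r2N small large.
(* With [J > N] the [+ 1] in [few_dilations] is absorbed by [J / N]. *)
have [J NJ] := INR_unbounded N.
have J1 : 0 < INR J by lra.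
have J0 : (0 < J)%N by case: (J) J1 => //=; lra.
have c2 := pow_R1_Rle c 2 c1; have rr := pow_lt r 2 (proj1 r01).
have rr1 : r ^ 2 <= r by nra.
(* Width at most [c / r] at the nearby quotient, plus [3 * eta * (2 * (c * N)) = 6 * c ^ 2 / r ^ 2]
   for moving to the grid point. *)
pose g := 7 * c ^ 2 / r ^ 2.
have ir : 1 <= / r ^ 2 by rewrite -Rinv_1; apply: Rinv_le_contravar; lra.
have irho : 1 <= / rho by rewrite -Rinv_1; apply: Rinv_le_contravar; lra.
have g1 : 1 <= 2 * g.
  have : 1 <= 7 * c ^ 2 * / r ^ 2 by apply: Rmult_ge1; lra.
  by rewrite /g /Rdiv; lra.
set m := INR (size T).
pose E := m1 * (32 * c ^ 2 / rho) * n.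
have crho : 1 <= 32 * c ^ 2 / rho by apply: Rmult_ge1; lra.
have E0 : 0 < E by apply: Rmult_lt_0_compat => //; apply: Rmult_lt_0_compat; lra.
pose y j := INR j / INR J.
pose coll j := (\sum_(p <- TT) \sum_(q <- TT) (close g (y j) p q : nat))%N.
have lower j : (j < J)%N -> m ^ 4 <= E * INR (coll j).
  move=> jJ.
  have y01 : 0 <= y j <= 1.
    have := pos_INR j; have : INR j <= INR J by apply: INR_leq; lia.
    move=> h1 h2; split; first by apply: Rmult_le_pos => //; apply: Rlt_le; exact: Rinv_0_lt_compat.
    apply: (Rmult_le_reg_r (INR J)) => //.
    have -> : y j * INR J = INR j by rewrite /y; field; repeat split; lra.
    lra.
  have [x [a [b [d [e [aT bT dT eT [far xE]]]]]] xy] := quotient_dense y01.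
  have x3 : Rabs x <= 3.
    by move: xy; rewrite /Rabs; do 2 case: Rcase_abs; lra.
  have xE' : x * IZR (1 * (d - e)) = IZR (a - b + 0 * (d - e)).
    by rewrite Z.mul_1_l Z.add_0_r.
  have := @collisions_lower_bound 1 0 a b d e x ltac:(lia) ltac:(lia) aT bT dT eT (nonzero_diff far) xE' x3.
  set D := Rabs (IZR (d - e)) in far *; rewrite -/m => lb.
  have D0 : 0 < D by lra.
  have DN : D <= 2 * (c * N).
    have h1 := TN dT; have h2 := TN eT.
    rewrite /D minus_IZR; apply: Rle_trans (Rabs_triang _ _) _; rewrite Rabs_Ropp; lra.
  have sub : (\sum_(p <- TT) \sum_(q <- TT) (close (c * N / D) x p q : nat) <= coll j)%N.
    rewrite big_seq /coll [leqRHS]big_seq; apply: leq_sum => p /memTT[p1 p2].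
    rewrite big_seq [leqRHS]big_seq; apply: leq_sum => q /memTT[q1 q2].
    rewrite {1}/close; case: RltbP => //= cl.
    suff -> : close g (y j) p q by [].
    apply/RltbP.
    have vb : Rabs (IZR (p.2 - q.2)) <= 2 * (c * N).
      have h1 := TN p2; have h2 := TN q2.
      rewrite minus_IZR; apply: Rle_trans (Rabs_triang _ _) _; rewrite Rabs_Ropp; lra.
    have -> : IZR (p.1 - q.1) + y j * IZR (p.2 - q.2) =
      (IZR (p.1 - q.1) + x * IZR (p.2 - q.2)) + - (x - y j) * IZR (p.2 - q.2) by ring.
    apply: Rle_lt_trans (Rabs_triang _ _) _; rewrite (Rabs_mult (- _)) Rabs_Ropp.
    have h1 := Rmult_le_compat _ _ _ _ (Rabs_pos _) (Rabs_pos _) xy vb.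
    have h2 : c * N / D <= c / r.
      apply: (Rmult_le_reg_r (D * r)); first by apply: Rmult_lt_0_compat; lra.
      have -> : c * N / D * (D * r) = c * (r * N) by field; repeat split; lra.
      have -> : c / r * (D * r) = c * D by field; repeat split; lra.
      by apply: Rmult_le_compat_l far; lra.
    have h3 : c / r <= c ^ 2 / r ^ 2.
      apply: (Rmult_le_reg_r (r ^ 2)) => //.
      have -> : c / r * r ^ 2 = c * r by field; repeat split; lra.
      have -> : c ^ 2 / r ^ 2 * r ^ 2 = c * c by field; repeat split; lra.
      by apply: Rmult_le_compat_l; lra.
    have h4 : 3 * eta * (2 * (c * N)) = 6 * (c ^ 2 / r ^ 2) by rewrite /eta; field; repeat split; lra.
    have h5 : g = 7 * (c ^ 2 / r ^ 2) by rewrite /g; field; repeat split; lra.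
    apply: Rlt_le_trans (Rplus_lt_le_compat _ _ _ _ cl h1) _; lra.
  (* Here [D] is simply bounded by [2 * c * N]; the gain will come from [r2]. *)
  have Rle : Rpower (16 * c * D / rho / N) s <= 32 * c ^ 2 / rho.
    apply: Rle_trans (_ : Rpower (32 * c ^ 2 / rho) s <= _).
      apply: Rpower_mono; first lra.
        by apply: Rdiv_lt_0_compat; [apply: Rdiv_lt_0_compat; last lra|lra];
          apply: Rmult_lt_0_compat; lra.
      apply: (Rmult_le_reg_r (rho * N)); first by apply: Rmult_lt_0_compat; lra.
      have -> : 16 * c * D / rho / N * (rho * N) = 16 * c * D by field; repeat split; lra.
      have -> : 32 * c ^ 2 / rho * (rho * N) = 16 * c * (2 * (c * N)) by field; repeat split; lra.
      by apply: Rmult_le_compat_l DN; lra.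
    have -> : 32 * c ^ 2 / rho = 32 * c ^ 2 / rho * 1 by ring.
    apply: Rle_trans (Rpower_scale _ crho Rlt_0_1) _; first lra.
    by rewrite /Rpower ln_1 Rmult_0_r exp_0; lra.
  apply: Rle_trans lb _; apply: Rmult_le_compat => //.
  - apply: Rmult_le_pos; last lra; apply: Rmult_le_pos; first lra.
    exact: Rlt_le (Rpower_gt0 _ _).
  - exact: pos_INR.
  - by apply: Rmult_le_compat_r; [lra|apply: Rmult_le_compat_l; lra].
  - exact: INR_leq.
have total : INR J * (m ^ 4 / E) <= INR (\sum_(j <- iota 0 J) coll j).
  rewrite -[X in INR X * _](size_iota 0 J); apply: sum_ge_constR => j.
  rewrite mem_iota add0n => jJ; apply: (Rmult_le_reg_r E) => //.
  have -> : m ^ 4 / E * E = m ^ 4 by field; repeat split; lra.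
  by have := lower j jJ; lra.
pose near (p q : Z * Z) := Rltb (Rabs (IZR (p.2 - q.2))) (r2 * N).
have split_sum : (\sum_(j <- iota 0 J) coll j <=
    \sum_(j <- iota 0 J) \sum_(p <- TT) \sum_(q <- TT) (near p q && close g (y j) p q : nat) +
    \sum_(p <- TT) \sum_(q <- TT) \sum_(j <- iota 0 J) (~~ near p q && close g (y j) p q : nat))%N.
  have -> : (\sum_(p <- TT) \sum_(q <- TT) \sum_(j <- iota 0 J) (~~ near p q && close g (y j) p q : nat) =
     \sum_(j <- iota 0 J) \sum_(p <- TT) \sum_(q <- TT) (~~ near p q && close g (y j) p q : nat))%N.
    by rewrite [RHS]exchange_big; apply: eq_bigr => p _; rewrite [RHS]exchange_big.
  rewrite -big_split /=; apply: leq_sum => j _; rewrite -big_split /=.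
  apply: leq_sum => p _; rewrite -big_split /=; apply: leq_sum => q _.
  by case: near; case: close.
have r2N0 : 0 < r2 * N by apply: Rmult_lt_0_compat; lra.
have g0 : 0 < g by lra.
have far_sum : INR (\sum_(p <- TT) \sum_(q <- TT) \sum_(j <- iota 0 J)
    (~~ near p q && close g (y j) p q : nat)) <= m ^ 4 * (2 * g * INR J / (r2 * N) + 1).
  have B0 : 0 <= 2 * g * INR J / (r2 * N) + 1.
    have : 0 < 2 * g * INR J / (r2 * N) by apply: Rdiv_lt_0_compat => //; apply: Rmult_lt_0_compat; lra.
    lra.
  have -> : m ^ 4 * (2 * g * INR J / (r2 * N) + 1) =
    INR (size TT) * (INR (size TT) * (2 * g * INR J / (r2 * N) + 1)).
    by rewrite size_allpairs INR_muln /m; ring.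
  apply: sum_le_constR => p _; apply: sum_le_constR => q _.
  rewrite /near; case: RltbP => /= [_|/Rnot_lt_le h]; first by rewrite big1.
  by rewrite -count_sum; exact: few_dilations.
have near_sum : INR (\sum_(j <- iota 0 J) \sum_(p <- TT) \sum_(q <- TT)
    (near p q && close g (y j) p q : nat)) <=
    INR J * (m ^ 2 * (m1 * Rpower (2 * (r2 * N) / N) s * n) * (m1 * Rpower (2 * g / N) s * n)).
  rewrite -[X in INR X * _](size_iota 0 J); apply: sum_le_constR => j _.
  exact (close_count uT frT m1n0 (y j) g1 r2N).
have := Rle_trans _ _ _ total (Rle_trans _ _ _ (INR_leq split_sum) _).
rewrite INR_addn => /(_ _ (Rplus_le_compat _ _ _ _ near_sum far_sum)) fin.
set R2 := Rpower (2 * (r2 * N) / N) s in fin; set R3 := Rpower (2 * g / N) s in fin.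
set R0 := Rpower (28 * c ^ 2 * r2 / r ^ 2) s in small.
have R00 : 0 < R0 by exact: Rpower_gt0.
have RE : R2 * R3 = R0 * Rpower (/ N) s.
  have iN : 0 < / N by apply: Rinv_0_lt_compat; lra.
  have q1 : 0 < 2 * (r2 * N) / N by apply: Rdiv_lt_0_compat; lra.
  have q2 : 0 < 2 * g / N by apply: Rdiv_lt_0_compat; lra.
  have q3 : 0 < 28 * c ^ 2 * r2 / r ^ 2.
    by apply: Rdiv_lt_0_compat => //; apply: Rmult_lt_0_compat; lra.
  by rewrite /R2 /R3 /R0 !Rpower_mult_distr //; congr (Rpower _ s); rewrite /g; field; repeat split; lra.
have m4 : 0 < m ^ 4 by exact: pow_lt.
have m2 : 0 < m ^ 2 by exact: pow_lt.
have nn : n * n <= m0 ^ 2 * m ^ 2.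
  by have := Rmult_le_compat _ _ _ _ (Rlt_le _ _ n0) (Rlt_le _ _ n0) nT nT; rewrite -/m; lra.
have part1 : E * (m ^ 2 * (m1 * R2 * n) * (m1 * R3 * n)) < m ^ 4 / 2.
  have -> : E * (m ^ 2 * (m1 * R2 * n) * (m1 * R3 * n)) =
    m1 ^ 3 * (32 * c ^ 2 / rho) * m ^ 2 * R0 * (n * n) * (n * Rpower (/ N) s).
    by rewrite /E; transitivity (m1 ^ 3 * (32 * c ^ 2 / rho) * m ^ 2 * (R2 * R3) * (n * n) * n);
      [ring|rewrite RE; ring].
  have W0 : 0 < m1 ^ 3 * (32 * c ^ 2 / rho) * m ^ 2 * R0.
    apply: Rmult_lt_0_compat => //; apply: Rmult_lt_0_compat => //.
    by apply: Rmult_lt_0_compat; [apply: pow_lt|]; lra.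
  have W1 : 0 <= m1 ^ 3 * (32 * c ^ 2 / rho) * m ^ 2 * R0 * (n * n).
    by apply: Rmult_le_pos; first lra; apply: Rmult_le_pos; lra.
  have h1 := Rmult_le_compat_l _ _ _ W1 n_N.
  have h2 := Rmult_le_compat_l _ _ _ (Rlt_le _ _ W0) nn.
  have h3 := Rmult_lt_compat_r _ _ _ m4 small.
  lra.
have part2 : E * (m ^ 4 * (2 * g * INR J / (r2 * N) + 1)) < INR J * m ^ 4 / 2.
  have h1 : 2 * g * INR J / (r2 * N) + 1 <= INR J * (15 * c ^ 2 / (r ^ 2 * r2)) / N.
    have i1 : 1 <= c ^ 2 / (r ^ 2 * r2).
      have i0 : 1 <= / r2 by rewrite -Rinv_1; apply: Rinv_le_contravar; lra.
      by rewrite /Rdiv Rinv_mult; apply: Rmult_ge1 => //; exact: Rmult_ge1.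
    have i2 : 1 <= INR J / N.
      apply: (Rmult_le_reg_r N); first lra.
      have -> : INR J / N * N = INR J by field; repeat split; lra.
      lra.
    have -> : 2 * g * INR J / (r2 * N) = 14 * (c ^ 2 / (r ^ 2 * r2) * (INR J / N)).
      by rewrite /g; field; repeat split; lra.
    have -> : INR J * (15 * c ^ 2 / (r ^ 2 * r2)) / N = 15 * (c ^ 2 / (r ^ 2 * r2) * (INR J / N)).
      by field; repeat split; lra.
    by have := Rmult_ge1 i1 i2; lra.
  have h2 : E * (INR J * (15 * c ^ 2 / (r ^ 2 * r2)) / N) < INR J / 2.
    have -> : E * (INR J * (15 * c ^ 2 / (r ^ 2 * r2)) / N) =
      INR J * (2 * (m1 * (32 * c ^ 2 / rho) * (15 * c ^ 2 / (r ^ 2 * r2)) * n)) * / N / 2.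
      by rewrite /E; field; repeat split; lra.
    apply: (Rmult_lt_reg_r N); first lra.
    set L := 2 * _ in large *.
    have -> : INR J * L * / N / 2 * N = INR J * L / 2 by field; repeat split; lra.
    by have := Rmult_lt_compat_l _ _ _ J1 large; lra.
  have h3 := Rmult_le_compat_l _ _ _ (Rlt_le _ _ E0) h1.
  have h4 : E * (2 * g * INR J / (r2 * N) + 1) < INR J / 2 by lra.
  have := Rmult_lt_compat_r _ _ _ m4 h4; lra.
have := Rmult_le_compat_l _ _ _ (Rlt_le _ _ E0) fin.
have -> : E * (INR J * (m ^ 4 / E)) = INR J * m ^ 4 by field; repeat split; lra.
have := Rmult_lt_compat_l _ _ _ J1 part1.
lra.
Qed.

End Quotients.

(** * The theorem for sets of integers *)

(** [M >= 2] lets constants be absorbed in powers of [M], so the class is closed under sums and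
    products and [poly_bound] can decide membership by syntax. *)
Definition poly_bounded (f : R -> R) : Prop :=
  exists e : nat, forall M, 2 <= M -> 0 <= f M <= M ^ e.

Lemma poly_bounded_eq f g : (forall M, 2 <= M -> f M = g M) -> poly_bounded g -> poly_bounded f.
Proof. by move=> fg [e ge]; exists e => M M2; rewrite fg //; exact: ge. Qed.

Lemma poly_bounded_const k : 0 <= k -> poly_bounded (fun _ => k).
Proof.
move=> k0; have [e he] := Pow_x_infinity 2 ltac:(rewrite Rabs_pos_eq; lra) k.
exists e => M M2; split => //.
have := he e (le_n e); rewrite Rabs_pos_eq; last by apply: pow_le; lra.
have := pow_incr 2 M e ltac:(lra); lra.
Qed.

Lemma poly_bounded_id : poly_bounded (fun M => M).
Proof. by exists 1%N => M M2; rewrite pow_1; lra. Qed.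

Lemma poly_bounded_mul f g : poly_bounded f -> poly_bounded g -> poly_bounded (fun M => f M * g M).
Proof.
move=> [e fe] [e' ge']; exists (e + e')%N => M M2; have [f0 f1] := fe M M2; have [g0 g1] := ge' M M2.
rewrite pow_add; split; [exact: Rmult_le_pos|exact: Rmult_le_compat].
Qed.

Lemma poly_bounded_add f g : poly_bounded f -> poly_bounded g -> poly_bounded (fun M => f M + g M).
Proof.
move=> [e fe] [e' ge']; exists (e + e' + 1)%N => M M2; have [f0 f1] := fe M M2; have [g0 g1] := ge' M M2.
have h1 := pow_R1_Rle M e ltac:(lra); have h2 := pow_R1_Rle M e' ltac:(lra).
rewrite !pow_add pow_1; split; first lra.
have : M ^ e + M ^ e' <= M ^ e * M ^ e' * 2 by nra.
have : M ^ e * M ^ e' * 2 <= M ^ e * M ^ e' * M by apply: Rmult_le_compat_l => //; nra.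
lra.
Qed.

Lemma poly_bounded_pow f k : poly_bounded f -> poly_bounded (fun M => f M ^ k).
Proof.
move=> fp; elim: k => [|k IH].
  by apply: (@poly_bounded_eq _ (fun _ => 1)) => //; apply: poly_bounded_const; lra.
by apply: (@poly_bounded_eq _ (fun M => f M * f M ^ k)) => //; exact: poly_bounded_mul.
Qed.

Ltac poly_bound :=
  repeat first [ exact poly_bounded_id | assumption
    | apply poly_bounded_const; lra
    | apply poly_bounded_pow | apply poly_bounded_mul | apply poly_bounded_add ].

(** Six products of elements of [T], with coefficients of absolute value at most 2, joined by five
    additions. *)
Definition quotc (K mg : R) (p2 p3 : Z) : R :=
  (2 * K ^ 5) ^ 5 * mulc K (formc K mg p2 (2 * p3)) 2 ^ 6.

Lemma mulc_le2 K m k : 1 <= K -> 1 <= m -> (Z.abs k <= 2)%Z -> mulc K m k <= mulc K m 2.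
Proof.
move=> K1 m1 k2; rewrite /mulc; apply: Rmult_le_compat_l; first lra.
apply: Rle_pow; last lia.
by have := pow_R1_Rle K 5 K1; nra.
Qed.

(** [d * u / w] is the good ratio [d / w] applied to a value [u] of the linear form on [A], hence a
    value of the same form on the dilate of [A] by [d / w], which is covered. *)
Lemma covered_quotient_form A K mg w (T : seq Z) p2 p3 al be a b d e :
  approximate A K -> 1 <= K -> 1 <= mg ->
  (forall k, k \in T -> form_values A p2 (2 * p3) (IZR k)) ->
  (forall k, k \in T -> covered A mg (fun z => exists2 x, x \in A & z = IZR k / w * IZR x)) ->
  (1 <= al <= 2)%Z -> (0 <= be <= 1)%Z -> w <> 0 ->
  a \in T -> b \in T -> d \in T -> e \in T ->
  covered A (quotc K mg p2 p3)
    (fun z => exists u v, [/\ u \in T, v \in T & z = quotient_form w al be a b d e (u, v)]).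
Proof.
move=> apA K1 mg1 TW Tc al12 be01 w0 aT bT dT eT.
set mu := formc K mg p2 (2 * p3).
have mu1 : 1 <= mu by exact: formc_ge1.
pose Y k z := exists2 u, u \in T & z = IZR k / w * IZR u.
have cY k : k \in T -> covered A mu (Y k).
  move=> kT; apply: covered_sub (covered_form p2 (2 * p3) apA K1 mg1 (Tc k kT)); first exact: Rle_refl.
  move=> z [u /TW[x [x' [y [y' [xA xA' yA yA' uE]]]]] ->].
  exists (IZR k / w * IZR x), (IZR k / w * IZR x'), (IZR k / w * IZR y), (IZR k / w * IZR y').
  split; [by exists x|by exists x'|by exists y|by exists y'|].
  by rewrite uE /lin !plus_IZR !mult_IZR !plus_IZR; ring.
have cZ k (i : Z) : k \in T -> (Z.abs i <= 2)%Z ->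
    covered A (mulc K mu 2) (fun z => exists2 y, Y k y & z = IZR i * y).
  move=> kT i2; apply: covered_sub (covered_mulZ apA i K1 mu1 (cY k kT)) => //.
  exact: mulc_le2.
have c1 := covered_add apA (fun z h => h) (cZ d al dT ltac:(lia)) (cZ e (- al)%Z eT ltac:(lia)).
have c2 := covered_add apA (fun z h => h) (cZ a 1%Z aT ltac:(lia)) (cZ b (-1)%Z bT ltac:(lia)).
have c3 := covered_add apA (fun z h => h) (cZ d be dT ltac:(lia)) (cZ e (- be)%Z eT ltac:(lia)).
have c4 := covered_add apA (fun z h => h) c2 c3.
apply: covered_sub (covered_add apA (fun z h => h) c1 c4).
  by rewrite /quotc -/mu; right; ring.
move=> z [u [v [uT vT ->]]].
exists (IZR al * (IZR d / w * IZR u) + IZR (- al) * (IZR e / w * IZR u)),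
  ((IZR 1 * (IZR a / w * IZR v) + IZR (-1) * (IZR b / w * IZR v)) +
   (IZR be * (IZR d / w * IZR v) + IZR (- be) * (IZR e / w * IZR v))); split.
- exists (IZR al * (IZR d / w * IZR u)), (IZR (- al) * (IZR e / w * IZR u)); split => //.
    by exists (IZR d / w * IZR u) => //; exists u.
  by exists (IZR e / w * IZR u) => //; exists u.
- exists (IZR 1 * (IZR a / w * IZR v) + IZR (-1) * (IZR b / w * IZR v)),
     (IZR be * (IZR d / w * IZR v) + IZR (- be) * (IZR e / w * IZR v)); split => //.
    exists (IZR 1 * (IZR a / w * IZR v)), (IZR (-1) * (IZR b / w * IZR v)); split => //.
      by exists (IZR a / w * IZR v) => //; exists v.
    by exists (IZR b / w * IZR v) => //; exists v.
  exists (IZR be * (IZR d / w * IZR v)), (IZR (- be) * (IZR e / w * IZR v)); split => //.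
    by exists (IZR d / w * IZR v) => //; exists v.
  by exists (IZR e / w * IZR v) => //; exists v.
- by rewrite /quotient_form /= !(minus_IZR, plus_IZR, mult_IZR, opp_IZR); field.
Qed.

(** Losses as functions of [M]: [rhoc] bounds the first derivative below relative to [N], [m0c]
    compares |A| with |T|, [mgc] counts translates for one good dilation, and [m1c] is the Frostman
    constant of [T] and of the images of [quotient_form]. *)
Definition rhoc (a : nat) (M : R) : R := / (2 * M ^ a).
Definition m0c (p1 p2 p3 : Z) (a : nat) (M : R) : R := ratc p1 p2 p3 M (rhoc a M).
Definition mgc p1 p2 p3 a M : R := m0c p1 p2 p3 a M * (2 * / rhoc a M + 2).
Definition m1c p1 p2 p3 a M : R :=
  12 * M ^ 7 * M * (formc M 1 p2 (2 * p3) + quotc M (mgc p1 p2 p3 a M) p2 p3).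

Lemma rhoc_inv a M : 2 <= M -> / rhoc a M = 2 * M ^ a.
Proof. by move=> M2; rewrite /rhoc Rinv_inv. Qed.

Lemma poly_bounded_m0c p1 p2 p3 a : poly_bounded (m0c p1 p2 p3 a).
Proof.
apply: (@poly_bounded_eq _ (fun M => 32 * M ^ 2 * (formc M 1 (2 * p1) p2 * M ^ 2) *
  (formc M 1 p2 (2 * p3) * M ^ 2) * (2 * M ^ a + 1))).
  by move=> M M2; rewrite /m0c /ratc rhoc_inv.
rewrite /formc /mulc; poly_bound.
Qed.

Lemma poly_bounded_m1c p1 p2 p3 a : poly_bounded (m1c p1 p2 p3 a).
Proof.
have mg : poly_bounded (mgc p1 p2 p3 a).
  apply: (@poly_bounded_eq _ (fun M => m0c p1 p2 p3 a M * (2 * (2 * M ^ a) + 2))).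
    by move=> M M2; rewrite /mgc rhoc_inv.
  have := poly_bounded_m0c p1 p2 p3 a => h; poly_bound.
rewrite /m1c /quotc /formc /mulc; poly_bound.
Qed.

Lemma form_values_bound A N k l z : (forall a, a \in A -> 0 <= IZR a <= N) -> 0 <= N ->
  form_values A k l z -> Rabs z <= 2 * (Rabs (IZR k) + Rabs (IZR l)) * N.
Proof.
move=> AN N0 [x [x' [y [y' [/AN hx /AN hx' /AN hy /AN hy' ->]]]]].
rewrite /lin plus_IZR !mult_IZR !plus_IZR.
apply: Rle_trans (Rabs_triang _ _) _; rewrite !Rabs_mult.
have h1 : Rabs (IZR x + IZR x') <= 2 * N by rewrite Rabs_pos_eq; lra.
have h2 : Rabs (IZR y + IZR y') <= 2 * N by rewrite Rabs_pos_eq; lra.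
have := Rmult_le_compat_l _ _ _ (Rabs_pos (IZR k)) h1.
have := Rmult_le_compat_l _ _ _ (Rabs_pos (IZR l)) h2; lra.
Qed.

Lemma sum_product_integers (s : R) (p1 p2 p3 : Z) :
  0 < s < 1 -> (p2 * p2 - 4 * p1 * p3 <> 0)%Z ->
  exists e : nat, forall (M N : R) (A V : seq Z), 2 <= M -> M ^ e <= N ->
  uniq A -> A != [::] -> (forall a, a \in A -> 0 <= IZR a <= N) ->
  frostman s N M (INR (size A)) A -> INR (size A) <= 2 * Rpower N s ->
  INR (size (sums A A)) <= M * INR (size A) ->
  uniq V -> INR (size V) <= M * INR (size A) ->
  (forall x y, x \in A -> y \in A -> floor (qf p1 p2 p3 (IZR x) (IZR y) / N) \in V) -> False.
Proof.
move=> s01 disc.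
(* With [2 * rhoc a M = M ^ (- a)] this gives [M * Rpower (2 * rhoc a M) s <= / M]. *)
have [a as2] : exists a : nat, 2 <= INR a * s.
  have [a ha] := INR_unbounded (2 / s); exists a.
  have := Rmult_lt_compat_r s _ _ (proj1 s01) ha.
  have -> : 2 / s * s = 2 by field; repeat split; lra.
  lra.
pose c := 1 + 4 * Rabs (IZR p1) + 2 * Rabs (IZR p2) + 4 * Rabs (IZR p3).
have c1 : 1 <= c.
  by have := Rabs_pos (IZR p1); have := Rabs_pos (IZR p2); have := Rabs_pos (IZR p3); rewrite /c; lra.
have c2 := pow_R1_Rle c 2 c1.
have pm0 := poly_bounded_m0c p1 p2 p3 a; have pm1 := poly_bounded_m1c p1 p2 p3 a.
have [d hd] : poly_bounded (fun M => 64 * c ^ 2 * M ^ a) by poly_bound.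
have [e1 he1] : poly_bounded (fun M => 4 * m0c p1 p2 p3 a M ^ 2 * m1c p1 p2 p3 a M ^ 3 *
    (32 * c ^ 2 * M ^ a)) by poly_bound.
(* [r] will be [M ^ (- b)]: [d] absorbs the constants inside the power [s], and [a * s >= 2] lets
   the rest beat the bound [M ^ e1] outside it. *)
pose b := (d + a * (e1 + 1))%N.
(* All the lower bounds required of [N]; the first summand is the one required of [N ^ (1 - s)]. *)
have [e2 he2] : poly_bounded (fun M => 8 * (m1c p1 p2 p3 a M * (32 * c ^ 2 * M ^ a) *
    (15 * c ^ 2 * M ^ (5 * b))) + 3 * c * M ^ (2 * b) + M ^ (3 * b) + M ^ a) by poly_bound.
(* [k * (1 - s) >= 1] turns [M ^ (k * (e2 + 1)) <= N] into [2 * M ^ e2 <= N ^ (1 - s)]; this is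
   where [s < 1] is decisive. *)
have [k hk] := INR_unbounded (/ (1 - s)).
have k1 : 1 <= INR k * (1 - s).
  have := Rmult_lt_compat_r (1 - s) _ _ ltac:(lra) hk; rewrite Rinv_l; lra.
exists (k * (e2 + 1))%N => M N A V M2 MN uA A0 AN fr sA AA uV sV AV.
have M0 : 0 < M by lra.
have M1 : 1 <= M by lra.
have Mpow j : 1 <= M ^ j by exact: pow_R1_Rle.
have Rpow j : Rpower (M ^ j) s = Rpower M (INR j * s) by rewrite -Rpower_pow // Rpower_mult.
have Rinvpow j : Rpower (/ M ^ j) s = / Rpower M (INR j * s).
  rewrite -Rpow -{1}(Rpower_1 (M ^ j)); last by have := Mpow j; lra.
  by rewrite -Rpower_Ropp Rpower_mult -Ropp_mult_distr_l Rmult_1_l Rpower_Ropp.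
have k0 : (1 <= k)%N.
  by case: (k) k1 => [|k'] //=; lra.
have ME : M ^ e2 * 2 <= M ^ (k * (e2 + 1)).
  apply: Rle_trans (_ : M ^ (e2 + 1) <= _); first by rewrite pow_add pow_1; have := Mpow e2; nra.
  by apply: Rle_pow => //; nia.
have N0 : 1 <= N by have := Mpow (k * (e2 + 1))%N; lra.
have NE : Rpower N s * (2 * M ^ e2) <= N.
  have NsE : Rpower N s * Rpower N (1 - s) = N.
    by rewrite -Rpower_plus -[RHS]Rpower_1; [congr Rpower|]; lra.
  apply: Rle_trans (Req_le _ _ NsE); apply: Rmult_le_compat_l; first exact: Rlt_le (Rpower_gt0 _ _).
  apply: Rle_trans (_ : M ^ (e2 + 1) <= _); first by rewrite pow_add pow_1; have := Mpow e2; nra.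
  apply: Rle_trans (_ : Rpower (M ^ (k * (e2 + 1))) (1 - s) <= _); last first.
    by apply: Rpower_mono => //; [lra|have := Mpow (k * (e2 + 1))%N; lra].
  rewrite -!Rpower_pow // Rpower_mult; apply: Rle_Rpower => //.
  rewrite INR_muln.
  have := Rmult_le_compat_l _ _ _ (pos_INR (e2 + 1)) k1; lra.
have NE2 : M ^ e2 <= N by have := Mpow e2; lra.
have [h1 /Rle_trans/(_ NE2) h2] := he2 M M2.
have [h3 h4] := hd M M2; have [h5 h6] := he1 M M2.
have nA : 0 < INR (size A) by apply: INR_size_gt0; case: (A) A0.
have Ma := Mpow a; have Mb := Mpow b.
have rho_lt : rhoc a M = / M ^ a / 2 by rewrite /rhoc; field; repeat split; lra.
have rho2 : 2 * rhoc a M = / M ^ a by rewrite rho_lt; field; repeat split; lra.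
have iMa : 0 < / M ^ a <= 1.
  by split; [apply: Rinv_0_lt_compat; lra|rewrite -Rinv_1; apply: Rinv_le_contravar; lra].
have rho0 : 0 < rhoc a M by lra.
have m0ge : 1 <= m0c p1 p2 p3 a M.
  have f1 := formc_ge1 (2 * p1) p2 M1 (Rle_refl 1); have f2 := formc_ge1 p2 (2 * p3) M1 (Rle_refl 1).
  have M2' := Mpow 2%N.
  rewrite /m0c /ratc rhoc_inv //.
  have g1 := Rmult_ge1 f1 M2'; have g2 := Rmult_ge1 f2 M2'.
  by apply: Rmult_ge1; last lra; do 2 (apply: Rmult_ge1 => //); lra.
have mgge : 1 <= mgc p1 p2 p3 a M by rewrite /mgc rhoc_inv //; nra.
set m0 := m0c p1 p2 p3 a M in h5 h6 m0ge *.
set m1 := m1c p1 p2 p3 a M in h1 h2 h5 h6.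
have F1 := formc_ge1 p2 (2 * p3) M1 (Rle_refl 1).
have Q1 : 1 <= quotc M (mgc p1 p2 p3 a M) p2 p3.
  have q1 : 1 <= (2 * M ^ 5) ^ 5 by apply: pow_R1_Rle; have := Mpow 5%N; lra.
  have q2 : 1 <= mulc M (formc M (mgc p1 p2 p3 a M) p2 (2 * p3)) 2 ^ 6.
    by apply/pow_R1_Rle/mulc_ge1 => //; exact: formc_ge1.
  by rewrite /quotc; nra.
have m1ge : 1 <= m1.
  have M7 := Mpow 7%N; rewrite /m1 /m1c; apply: Rmult_ge1; last lra.
  by apply: Rmult_ge1; lra.
have apA := approximate_of_doubling uA A0 AA.
have as2' : Rpower M 2 <= Rpower M (INR a * s) by apply: Rle_Rpower.
have frC : M * Rpower (2 * rhoc a M) s <= / 2.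
  rewrite rho2 Rinvpow.
  have M22 : Rpower M 2 = M * M.
    by rewrite (_ : 2 = 1 + 1) ?Rpower_plus ?Rpower_1 //; lra.
  apply: Rle_trans (_ : M * / (M * M) <= _).
    apply: Rmult_le_compat_l; first lra.
    by apply: Rinv_le_contravar; [apply: Rmult_lt_0_compat|]; lra.
  have -> : M * / (M * M) = / M by field; repeat split; lra.
  by apply: Rinv_le_contravar; lra.
have large_rho : 1 <= 2 * rhoc a M * N.
  rewrite rho2; apply: (Rmult_le_reg_l (M ^ a)); first lra.
  have -> : M ^ a * (/ M ^ a * N) = N by field; repeat split; lra.
  have : 0 <= 8 * (m1 * (32 * c ^ 2 * M ^ a) * (15 * c ^ 2 * M ^ (5 * b))).
    have := Mpow (5 * b)%N => M5; repeat apply: Rmult_le_pos; lra.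
  have := Mpow (3 * b)%N.
  have : 0 <= 3 * c * M ^ (2 * b) by have := Mpow (2 * b)%N => M4; apply: Rmult_le_pos; lra.
  lra.
have Npos : 0 < N by lra.
have M0' : 0 <= M by lra.
have [w [T [uT [wW wN] TW nT Tc]]] := many_good_ratios disc apA M1 AA s01
  Npos rho0 large_rho fr M0' frC uV sV AV.
have cNw : Rabs (IZR w) <= c * N.
  apply: Rle_trans (form_values_bound AN _ wW) _; first lra.
  rewrite mult_IZR Rabs_mult (Rabs_pos_eq 2); last lra.
  apply: Rmult_le_compat_r; first lra.
  by have := Rabs_pos (IZR p2); have := Rabs_pos (IZR p3); rewrite /c; lra.
have cNT t : t \in T -> Rabs (IZR t) <= c * N.
  move=> /TW tW; apply: Rle_trans (form_values_bound AN _ tW) _; first lra.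
  rewrite mult_IZR Rabs_mult (Rabs_pos_eq 2); last lra.
  apply: Rmult_le_compat_r; first lra.
  by have := Rabs_pos (IZR p1); rewrite /c; lra.
have w0 : IZR w <> 0 by move=> E; move: wN; rewrite E Rabs_R0; lra.
have m1_local m l : 0 <= m <= formc M 1 p2 (2 * p3) + quotc M (mgc p1 p2 p3 a M) p2 p3 ->
    12 * M ^ 7 * M * m * Rpower (l / N) s * INR (size A) <= m1 * Rpower (l / N) s * INR (size A).
  move=> mm; apply: Rmult_le_compat_r; first lra.
  apply: Rmult_le_compat_r; first exact: Rlt_le (Rpower_gt0 _ _).
  by apply: Rmult_le_compat_l; [apply: Rmult_le_pos; first have := Mpow 7%N; lra|lra].
have frT : frostman s N m1 (INR (size A)) T.
  move=> x l l1 zs uz zT zx; apply: Rle_trans (m1_local (formc M 1 p2 (2 * p3)) l _); last lra.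
  apply: (covered_local_count apA s01 _ _ fr
    (X := fun z => form_values A p2 (2 * p3) z /\ x <= z <= x + l)) => //; try lra.
  - apply: covered_sub (covered_form_values p2 (2 * p3) apA M1); first exact: Rle_refl.
    by move=> z [].
  - by move=> z z' [_ h] [_ h']; rewrite /Rabs; case: Rcase_abs; lra.
  - move=> z zz; exists (IZR z); last by rewrite floor_IZR.
    by split; [exact/TW/zT|exact: zx].
have frH al be a' b' d' e' : (1 <= al <= 2)%Z -> (0 <= be <= 1)%Z ->
  a' \in T -> b' \in T -> d' \in T -> e' \in T ->
  forall l, 1 <= l ->
  (forall u v, u \in T -> v \in T -> Rabs (quotient_form (IZR w) al be a' b' d' e' (u, v)) <= l / 2) ->
  forall zs, uniq zs ->
  (forall z, z \in zs -> exists u v,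
    [/\ u \in T, v \in T & z = floor (quotient_form (IZR w) al be a' b' d' e' (u, v))]) ->
  INR (size zs) <= m1 * Rpower (l / N) s * INR (size A).
  move=> al12 be01 aT bT dT eT l l1 hl zs uz zX.
  apply: Rle_trans (m1_local (quotc M (mgc p1 p2 p3 a M) p2 p3) l _); last lra.
  apply: (covered_local_count apA s01 _ _ fr
    (covered_quotient_form apA M1 mgge TW Tc al12 be01 w0 aT bT dT eT)) => //; try lra.
    move=> _ _ [u [v [uT' vT' ->]]] [u' [v' [uT'' vT'' ->]]].
    have := hl _ _ uT' vT'; have := hl _ _ uT'' vT''.
    by rewrite /Rabs; do 3 case: Rcase_abs; lra.
  move=> z /zX[u [v [uT' vT' ->]]]; exists (quotient_form (IZR w) al be a' b' d' e' (u, v)) => //.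
  by exists u, v.
have iMb : 0 < / M ^ b <= 1.
  by split; [apply: Rinv_0_lt_compat; lra|rewrite -Rinv_1; apply: Rinv_le_contravar; lra].
have rsmall t : 0 < t <= 64 * c ^ 2 * M ^ a ->
  4 * m0 ^ 2 * m1 ^ 3 * (32 * c ^ 2 * M ^ a) * Rpower (t * / M ^ b) s < 1.
  move=> t0.
  have R0 : Rpower (t * / M ^ b) s <= / M ^ (e1 + 1).
    apply: Rle_trans (_ : Rpower (/ M ^ (a * (e1 + 1))) s <= _).
      apply: Rpower_mono; [lra|by apply: Rmult_lt_0_compat; lra|].
      rewrite /b pow_add Rinv_mult.
      have i1 : 0 < / M ^ d by apply: Rinv_0_lt_compat; have := Mpow d; lra.
      have i2 : 0 < / M ^ (a * (e1 + 1)) by apply: Rinv_0_lt_compat; have := Mpow (a * (e1 + 1))%N; lra.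
      rewrite -Rmult_assoc -[X in _ <= X]Rmult_1_l; apply: Rmult_le_compat_r; first lra.
      apply: (Rmult_le_reg_r (M ^ d)); first by have := Mpow d; lra.
      rewrite Rmult_assoc Rinv_l; last by have := Mpow d; lra.
      lra.
    rewrite Rinvpow; apply: Rinv_le_contravar; first by have := Mpow (e1 + 1)%N; lra.
    rewrite -Rpower_pow //; apply: Rle_Rpower => //.
    rewrite INR_muln; have := Rmult_le_compat_r _ _ _ (pos_INR (e1 + 1)) as2.
    have := pos_INR (e1 + 1); lra.
  apply: Rle_lt_trans (Rmult_le_compat _ _ _ _ h5 (Rlt_le _ _ (Rpower_gt0 _ _)) h6 R0) _.
  rewrite pow_add pow_1; have := Mpow e1 => Me1.
  have -> : M ^ e1 * / (M ^ e1 * M) = / M by field; repeat split; lra.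
  by rewrite -Rinv_1; apply: Rinv_lt_contravar; lra.
clearbody b.
have cM1 : 1 <= 32 * c ^ 2 * M ^ a by apply: Rmult_ge1; lra.
have M2b := Mpow (2 * b)%N; have M3b := Mpow (3 * b)%N; have M5b := Mpow (5 * b)%N.
have big0 : 0 < m1 * (32 * c ^ 2 * M ^ a) * (15 * c ^ 2 * M ^ (5 * b)).
  by apply: Rmult_lt_0_compat; apply: Rmult_lt_0_compat; lra.
have cb0 : 0 < 3 * c * M ^ (2 * b) by apply: Rmult_lt_0_compat; lra.
have MbN : M ^ b <= N.
  by have : M ^ b <= M ^ (3 * b) by [apply: Rle_pow => //; lia]; lra.
have i2b : (/ M ^ b) ^ 2 = / M ^ (2 * b).
  by rewrite pow_inv -pow_mult; congr (/ _ ^ _); lia.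
have ic : 32 * c ^ 2 / (2 * rhoc a M) = 32 * c ^ 2 * M ^ a by rewrite rho2; field; repeat split; lra.
(* [r2 = M ^ (- 3 * b)] makes [r2 / r ^ 2 = M ^ (- b)], so [rsmall] serves for both smallness
   conditions. *)
apply: (collisions_average uT s01 N0 nA sA c1 (rho := 2 * rhoc a M) (m0 := m0) (m1 := m1)
   (w := IZR w) _ m0ge m1ge _ cNT nT frT frH (r := / M ^ b) iMb _ _ _ (r2 := / M ^ (3 * b))).
- by rewrite rho2.
- by split; lra.
- apply: (Rmult_le_reg_l (M ^ b)); first lra.
  by have -> : M ^ b * (/ M ^ b * N) = N by [field; repeat split; lra]; lra.
- have -> : 64 * c ^ 2 * / M ^ b / (2 * rhoc a M) = 64 * c ^ 2 * M ^ a * / M ^ b.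
    by rewrite rho2; field; repeat split; lra.
  have rs := rsmall (64 * c ^ 2 * M ^ a) ltac:(lra).
  apply: Rle_lt_trans rs; apply: Rmult_le_compat_r; first exact: Rlt_le (Rpower_gt0 _ _).
  have : 0 <= m0 ^ 2 * m1 ^ 3 by apply: Rmult_le_pos; apply: pow_le; lra.
  move=> h0; have := Rmult_le_compat_l _ _ _ h0 cM1; lra.
- rewrite i2b; apply: (Rmult_le_reg_r N); first lra.
  have -> : 3 * (c / (/ M ^ (2 * b) * N)) * N = 3 * c * M ^ (2 * b) by field; repeat split; lra.
  lra.
- by split; [apply: Rinv_0_lt_compat; lra|rewrite -Rinv_1; apply: Rinv_le_contravar; lra].
- apply: (Rmult_le_reg_l (M ^ (3 * b))); first lra.
  have -> : M ^ (3 * b) * (2 * (/ M ^ (3 * b) * N)) = 2 * N by field; repeat split; lra.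
  lra.
- rewrite ic.
  have -> : 28 * c ^ 2 * / M ^ (3 * b) / (/ M ^ b) ^ 2 = 28 * c ^ 2 * / M ^ b.
    rewrite i2b (_ : (3 * b = 2 * b + b)%N) ?pow_add; last lia.
    by field; repeat split; lra.
  apply: rsmall; split; first lra.
  apply: Rle_trans (_ : 28 * c ^ 2 * M ^ a <= _); last lra.
  by rewrite -[X in X <= _]Rmult_1_r; apply: Rmult_le_compat_l; lra.
- rewrite ic i2b.
  have -> : 15 * c ^ 2 / (/ M ^ (2 * b) * / M ^ (3 * b)) = 15 * c ^ 2 * M ^ (5 * b).
    rewrite (_ : (5 * b = 2 * b + 3 * b)%N) ?pow_add; last lia.
    by field; repeat split; lra.
  set X := m1 * _ * _ in big0 h1 h2 *.
  apply: Rle_lt_trans (Rmult_le_compat_l 2 _ _ _ (Rmult_le_compat_l X _ _ (Rlt_le _ _ big0) sA)) _; first lra.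
  apply: Rlt_le_trans NE.
  have XE : 8 * X <= M ^ e2.
    have [_ h7] := he2 M M2; rewrite -/m1 -/X in h7; lra.
  have RN := Rpower_gt0 N s.
  have := Rmult_le_compat_l _ _ _ (Rlt_le _ _ RN) XE.
  have := Rmult_lt_0_compat _ _ RN big0; lra.
Qed.

(** * Discretization *)

(** [epsilon] is specified only if a minimum exists; any finite cover provides one by
    well-ordering. *)
Lemma covering_number_attained delta E L : covered_by delta E L ->
  exists L', length L' = covering_number delta E /\ covered_by delta E L'.
Proof.
move=> cL.
have [n [[cn mn] _]] : exists ! n, coverable delta E n /\ forall m, coverable delta E m -> (n <= m)%coq_nat.
  apply: dec_inh_nat_subset_has_unique_least_element; first by move=> n; exact: classic.
  by exists (length L), L.
have ex : exists n, coverable delta E n /\ forall m, coverable delta E m -> (n <= m)%coq_nat by exists n.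
by have [[L' [sL' cL']] _] := epsilon_spec (inhabits 0%nat) _ ex; exists L'.
Qed.

Lemma covered_by_self delta E L : 0 < delta -> (forall x, E x -> In x L) -> covered_by delta E L.
Proof. by move=> d0 EL x /EL xL; exists x; split => //; lra. Qed.

Lemma mem_map_list (T : Type) (f : T -> Z) (L : list T) z :
  z \in [seq f x | x <- L] <-> exists2 x, In x L & z = f x.
Proof.
elim: L => [|y L [IH1 IH2]] /=; first by split => [//|[x []]].
rewrite inE; split => [/orP[/eqP->|h]|[x [->|xL] e]].
- by exists y => //; left.
- by have [x xL ->] := IH1 h; exists x => //; right.
- by rewrite e eqxx.
- by apply/orP; right; apply: IH2; exists x.
Qed.

Lemma uniq_map_list (T : Type) (f : T -> Z) (L : list T) :
  NoDup L -> (forall x y, In x L -> In y L -> f x = f y -> x = y) -> uniq [seq f x | x <- L].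
Proof.
elim: L => [//|x L IH] nd inj /=; have [nx nL] := proj1 (NoDup_cons_iff x L) nd.
apply/andP; split; last by apply: IH => // y z yL zL; apply: inj; right.
apply/negP => /mem_map_list[y yL e]; apply: nx.
by rewrite (inj x y) //; [left|right].
Qed.

(** The integers in a window of length [w] from [g c] are among [floor (g c) + i] with [i < k]. *)
Lemma size_le_cells (zs : seq Z) (L : list R) (g : R -> R) (w : R) (k : nat) :
  uniq zs -> w + 1 <= INR k ->
  (forall z, z \in zs -> exists2 c, In c L & g c <= IZR z <= g c + w) ->
  INR (size zs) <= INR (length L) * INR k.
Proof.
move=> uz wk zL; rewrite -INR_muln; apply: INR_leq.
have -> : length L = size [seq floor (g c) | c <- L] by rewrite size_map.
rewrite -(size_iota 0 k) -(size_allpairs (fun z i => z + Z.of_nat i)%Z).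
apply: uniq_leq_size => // z /zL[c cL hz].
have hf := floor_spec (g c).
have z1 : (floor (g c) - 1 < z)%Z by apply: lt_IZR; rewrite minus_IZR; lra.
have z2 : (z - floor (g c) < Z.of_nat k)%Z.
  by apply: lt_IZR; rewrite minus_IZR -INR_IZR_INZ; lra.
apply/allpairsP; exists (floor (g c), Z.to_nat (z - floor (g c))); split => /=.
- by apply/mem_map_list; exists c.
- by rewrite mem_iota; lia.
- lia.
Qed.

Lemma Rceil_lt x : IZR (Rceil x) < x + 1.
Proof. by rewrite /Rceil minus_IZR; have [] := archimed (- x); lra. Qed.

Lemma sumset_cover delta B : 0 < delta -> exists L,
  length L = covering_number delta (sumset B) /\ covered_by delta (sumset B) L.
Proof.
move=> d0; apply: (@covering_number_attained _ _ (List.map (fun p => p.1 + p.2) (list_prod B B))).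
apply: covered_by_self => // z [b [b' [bB [bB' ->]]]].
by apply/in_map_iff; exists (b, b'); split => //; exact: in_prod.
Qed.

Lemma qform_set_cover delta a1 a2 a3 B : 0 < delta -> exists L,
  length L = covering_number delta (qform_set a1 a2 a3 B) /\
  covered_by delta (qform_set a1 a2 a3 B) L.
Proof.
move=> d0; apply: (@covering_number_attained _ _
  (List.map (fun p => qform a1 a2 a3 p.1 p.2) (list_prod B B))).
apply: covered_by_self => // z [b [b' [bB [bB' ->]]]].
by apply/in_map_iff; exists (b, b'); split => //; exact: in_prod.
Qed.

Section Discretize.

Variables (delta N : R).
Hypothesis d0 : 0 < delta.
Hypothesis NE : N = / delta.
Hypothesis N1 : 1 <= N.

Definition cell (b : R) : Z := floor (b / delta).

Let dN : delta * N = 1. Proof. by rewrite NE; field; lra. Qed.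

Lemma cell_spec b : IZR (cell b) <= N * b < IZR (cell b) + 1.
Proof. by have := floor_spec (b / delta); rewrite /cell NE /Rdiv; lra. Qed.

Lemma cell_range b : 0 <= b <= 1 -> 0 <= IZR (cell b) <= N.
Proof.
move=> b01; have h := cell_spec b.
have : (-1 < cell b)%Z by apply: lt_IZR; nra.
by move=> h0; split; [apply: IZR_le; lia|nra].
Qed.

Lemma cell_inj A a b : delta_separated delta A -> In a A -> In b A -> cell a = cell b -> a = b.
Proof.
move=> sep aA bA e; have ha := cell_spec a; have hb := cell_spec b; rewrite e in ha.
case: (Req_dec a b) => // ab; have := sep a b aA bA ab.
have : Rabs (N * (a - b)) < 1 by rewrite /Rabs; case: Rcase_abs; lra.
rewrite Rabs_mult (Rabs_pos_eq N); last lra.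
move=> h1 h2; have : N * delta <= N * Rabs (a - b) by apply: Rmult_le_compat_l; lra.
lra.
Qed.

(** The extra 1 in the length pays for rounding down to cells. *)
Lemma count_in_cells A x l (zs : seq Z) : uniq zs -> {subset zs <= [seq cell a | a <- A]} ->
  (forall z, z \in zs -> x <= IZR z <= x + l) ->
  (size zs <= count_in A (x * delta) ((l + 1) * delta))%N.
Proof.
move=> uz zA zx; rewrite /count_in; set P := fun a : R => _.
have -> : length (List.filter P A) = size [seq cell a | a <- List.filter P A] by rewrite size_map.
apply: uniq_leq_size => // z zz; have /mem_map_list[a aA e] := zA z zz.
apply/mem_map_list; exists a => //; apply/filter_In; split => //.
have h := zx z zz; have ha := cell_spec a; rewrite -e in ha.
have aE : a = N * a * delta by rewrite NE; field; lra.
rewrite /P; case: Rle_dec => [_|]; last by case; rewrite aE; apply: Rmult_le_compat_r; lra.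
case: Rle_dec => // -[]; rewrite aE.
have -> : x * delta + (l + 1) * delta = (x + l + 1) * delta by ring.
by apply: Rmult_le_compat_r; lra.
Qed.

Lemma sums_cells_le B : INR (size (sums [seq cell b | b <- B] [seq cell b | b <- B])) <=
  4 * INR (covering_number delta (sumset B)).
Proof.
have [L [<- cL]] := sumset_cover B d0.
rewrite Rmult_comm; have -> : 4 = INR 4 by rewrite /=; lra.
(* Rounding lowers a sum of two terms by less than 2, and an interval of length [delta] becomes one
   of length 1. *)
apply: (size_le_cells (g := fun c => c * N - 2) (w := 3)); first exact: sums_uniq.
  by rewrite /=; lra.
move=> z /sumsP[a [a' [/mem_map_list[b bB ->] /mem_map_list[b' bB' ->] ->]]].
have [|c [cL' hc]] := cL (b + b'); first by exists b, b'.
exists c => //; rewrite plus_IZR; have h := cell_spec b; have h' := cell_spec b'.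
have h1 : N * c <= N * (b + b') by apply: Rmult_le_compat_l; lra.
have h2 : N * (b + b') <= N * (c + delta) by apply: Rmult_le_compat_l; lra.
lra.
Qed.

(** The form has gradient O(N) on the square of side [N] and rounding moves each coordinate by less
    than 1, so the error is bounded after division by [N]. *)
Lemma qf_cell_error p1 p2 p3 b b' : 0 <= b <= 1 -> 0 <= b' <= 1 ->
  Rabs (qf p1 p2 p3 (IZR (cell b)) (IZR (cell b')) / N - N * qf p1 p2 p3 b b') <=
  2 * (Rabs (IZR p1) + Rabs (IZR p2) + Rabs (IZR p3)).
Proof.
move=> b01 b01'; have h := cell_spec b; have h' := cell_spec b'.
have [r1 r2] := cell_range b01; have [r1' r2'] := cell_range b01'.
set x := IZR (cell b) in h r1 r2 *; set y := IZR (cell b') in h' r1' r2' *.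
have Nb : 0 <= N * b <= N by nra.
have Nb' : 0 <= N * b' <= N by nra.
have E : qf p1 p2 p3 x y / N - N * qf p1 p2 p3 b b' =
  (IZR p1 * (x ^ 2 - (N * b) ^ 2) + IZR p2 * (x * y - N * b * (N * b')) +
   IZR p3 * (y ^ 2 - (N * b') ^ 2)) / N.
  by rewrite /qf; field; lra.
have e1 : Rabs (x ^ 2 - (N * b) ^ 2) <= 2 * N.
  have : 0 <= (N * b) ^ 2 - x ^ 2 <= 2 * N by split; nra.
  by rewrite /Rabs; case: Rcase_abs; lra.
have e2 : Rabs (x * y - N * b * (N * b')) <= 2 * N.
  have : 0 <= N * b * (N * b') - x * y <= 2 * N by split; nra.
  by rewrite /Rabs; case: Rcase_abs; lra.
have e3 : Rabs (y ^ 2 - (N * b') ^ 2) <= 2 * N.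
  have : 0 <= (N * b') ^ 2 - y ^ 2 <= 2 * N by split; nra.
  by rewrite /Rabs; case: Rcase_abs; lra.
rewrite E /Rdiv Rabs_mult Rabs_inv (Rabs_pos_eq N); last lra.
apply: (Rmult_le_reg_r N); first lra.
rewrite Rmult_assoc Rinv_l ?Rmult_1_r; last lra.
apply: Rle_trans (Rabs_triang _ _) _.
have := Rabs_triang (IZR p1 * (x ^ 2 - (N * b) ^ 2)) (IZR p2 * (x * y - N * b * (N * b'))).
rewrite !Rabs_mult.
have := Rmult_le_compat_l _ _ _ (Rabs_pos (IZR p1)) e1.
have := Rmult_le_compat_l _ _ _ (Rabs_pos (IZR p2)) e2.
have := Rmult_le_compat_l _ _ _ (Rabs_pos (IZR p3)) e3.
lra.
Qed.

Lemma qform_cells_le (a1 a2 a3 : Q) (p1 p2 p3 : Z) (q : R) (k : nat) B :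
  0 < q -> IZR p1 = q * Q2R a1 -> IZR p2 = q * Q2R a2 -> IZR p3 = q * Q2R a3 ->
  q + 4 * (Rabs (IZR p1) + Rabs (IZR p2) + Rabs (IZR p3)) + 2 <= INR k ->
  (forall b, In b B -> 0 <= b <= 1) ->
  let A := [seq cell b | b <- B] in
  INR (size (undup [seq floor (qf p1 p2 p3 (IZR x) (IZR y) / N) | x <- A, y <- A])) <=
  INR (covering_number delta (qform_set a1 a2 a3 B)) * INR k.
Proof.
move=> q0 e1 e2 e3 hk B01 A.
have [L [<- cL]] := qform_set_cover a1 a2 a3 B d0.
set C' := Rabs (IZR p1) + Rabs (IZR p2) + Rabs (IZR p3) in hk.
(* The window has length [q] from the covering interval, [2 * C'] of rounding error on each side,
   and 1 from the integer part. *)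
apply: (size_le_cells (g := fun c => q * N * c - 2 * C' - 1) (w := q + 4 * C' + 1)).
- exact: undup_uniq.
- lra.
move=> z; rewrite mem_undup => /allpairsP[[x y] [/= /mem_map_list[b bB ->] /mem_map_list[b' bB' ->] ->]].
have [|c [cL' hc]] := cL (qform a1 a2 a3 b b'); first by exists b, b'.
exists c => //.
have err := qf_cell_error p1 p2 p3 (B01 b bB) (B01 b' bB'); rewrite -/C' in err.
set v := qf _ _ _ _ _ / N in err *; have hv := floor_spec v.
have qE : N * qf p1 p2 p3 b b' = q * N * qform a1 a2 a3 b b'.
  by rewrite /qf /qform e1 e2 e3; ring.
have qN : 0 < q * N by nra.
have h1 : q * N * c <= q * N * qform a1 a2 a3 b b' by apply: Rmult_le_compat_l; lra.
have h2 : q * N * qform a1 a2 a3 b b' <= q * N * (c + delta) by apply: Rmult_le_compat_l; lra.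
have h3 : q * N * (c + delta) = q * N * c + q by rewrite -[X in _ + X = _]Rmult_1_r -dN || nra.
rewrite qE in err; move: err; rewrite /Rabs; case: Rcase_abs; lra.
Qed.

End Discretize.

(** * From integers back to the reals *)

Lemma integral_coefficients (a1 a2 a3 : Q) : ~ (a2 * a2 - 4 * a1 * a3 == 0)%Q ->
  exists (p1 p2 p3 : Z) (q : R), [/\ 0 < q,
    IZR p1 = q * Q2R a1 /\ IZR p2 = q * Q2R a2, IZR p3 = q * Q2R a3 &
    (p2 * p2 - 4 * p1 * p3 <> 0)%Z].
Proof.
move=> disc.
have E (a : Q) : IZR (Qnum a) = IZR (Zpos (Qden a)) * Q2R a /\ 0 < IZR (Zpos (Qden a)).
  have h : 0 < IZR (Zpos (Qden a)) by apply: IZR_lt.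
  by split => //; rewrite /Q2R; field; lra.
have [[e1 d1] [e2 d2] [e3 d3]] := And3 (E a1) (E a2) (E a3).
pose p1 := (Qnum a1 * Zpos (Qden a2) * Zpos (Qden a3))%Z.
pose p2 := (Qnum a2 * Zpos (Qden a1) * Zpos (Qden a3))%Z.
pose p3 := (Qnum a3 * Zpos (Qden a1) * Zpos (Qden a2))%Z.
pose q := IZR (Zpos (Qden a1)) * IZR (Zpos (Qden a2)) * IZR (Zpos (Qden a3)).
have q0 : 0 < q by apply: Rmult_lt_0_compat => //; exact: Rmult_lt_0_compat.
have f1 : IZR p1 = q * Q2R a1 by rewrite /p1 !mult_IZR e1 /q; ring.
have f2 : IZR p2 = q * Q2R a2 by rewrite /p2 !mult_IZR e2 /q; ring.
have f3 : IZR p3 = q * Q2R a3 by rewrite /p3 !mult_IZR e3 /q; ring.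
clearbody p1 p2 p3 q; exists p1, p2, p3, q; split => // d; apply: disc; apply: eqR_Qeq.
have four : Q2R 4 = 4 by rewrite /Q2R /=; lra.
rewrite Q2R_minus !Q2R_mult four [RHS]/Q2R /= Rmult_0_l.
have : IZR (p2 * p2 - 4 * p1 * p3) = 0 by rewrite d.
rewrite minus_IZR !mult_IZR f1 f2 f3 => h.
apply: (Rmult_eq_reg_l (q * q)); last by have := Rmult_lt_0_compat _ _ q0 q0; lra.
lra.
Qed.

Theorem theorem1p7 :
  forall s : R, 0 < s < 1 ->
  exists K : R, 0 < K /\
  forall a1 a2 a3 : Q, ~ (a2 * a2 - 4 * a1 * a3 == 0)%Q ->
  exists eps c0 : R, 0 < eps /\ 0 < c0 /\
  forall (C delta : R), 1 <= C -> 0 < delta ->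
  forall A : list R,
    NoDup A ->
    (forall a, In a A -> 0 <= a <= 1) ->
    delta_separated delta A ->
    Z.of_nat (length A) = Rceil (Rpower delta (- s)) ->
    (forall x l, delta <= l -> INR (count_in A x l) <= C * Rpower l s * INR (length A)) ->
  forall B : list R,
    NoDup B -> incl B A ->
    Rpower delta eps * INR (length A) <= INR (length B) ->
    c0 * Rpower C (- K) * Rpower delta (- eps) * INR (length A)
      <= INR (covering_number delta (sumset B))
         + INR (covering_number delta (qform_set a1 a2 a3 B)).
Proof.
(* The first power of [C] suffices: the covering number of B + B is at least |B| / 4, so the claim
   is trivial once [C] exceeds [N ^ (2 * eps)]. *)
move=> s s01; exists 1; split; first lra.
move=> a1 a2 a3 /integral_coefficients[p1 [p2 [p3 [q [q0 [f1 f2] f3 disc]]]]].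
have [e core] := sum_product_integers s01 disc.
have [k hk] := INR_unbounded (q + 4 * (Rabs (IZR p1) + Rabs (IZR p2) + Rabs (IZR p3)) + 2).
(* Then [M = N ^ (4 * eps)] has [M ^ e = N ^ (e / (e + 1)) <= N]. *)
pose eps := / (4 * (INR e + 1)).
have e0 := pos_INR e.
have eps0 : 0 < eps by apply: Rinv_0_lt_compat; lra.
(* For [N <= N0] the constant [c0] pushes the left side below 1, a trivial bound; for larger [N] the
   factor [N ^ eps] absorbs the constants. *)
pose N0 := Rpower (INR k + 4) (/ eps).
have k0 := pos_INR k.
have N01 : 1 <= N0.
  rewrite -(Rpower_O (INR k + 4)); last lra.
  by apply: Rle_Rpower; [lra|apply: Rlt_le; exact: Rinv_0_lt_compat].
have N0eps : Rpower N0 eps = INR k + 4.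
  by rewrite /N0 Rpower_mult Rinv_l ?Rpower_1; lra.
pose c0 := / (8 * (INR k + 4) * (Rpower N0 s + 1)).
have N0s := Rpower_gt0 N0 s.
have c0pos : 0 < c0 by apply: Rinv_0_lt_compat; nra.
have c08 : c0 * 8 <= 1.
  set D := 8 * (INR k + 4) * (Rpower N0 s + 1) in c0 c0pos *.
  have D8 : 8 <= D by rewrite /D; nra.
  apply: (Rmult_le_reg_r D); first lra.
  have -> : c0 * 8 * D = 8 by rewrite /c0; field; lra.
  lra.
exists eps, c0; split => //; split => // C delta C1 d0 A uA A01 sepA cA frA B uB BA sB.
have Cinv : Rpower C (- 1) = / C by rewrite Rpower_Ropp Rpower_1; lra.
have iC : 0 < / C <= 1.
  by split; [apply: Rinv_0_lt_compat; lra|rewrite -Rinv_1; apply: Rinv_le_contravar; lra].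
pose N := / delta.
have N00 : 0 < N by exact: Rinv_0_lt_compat.
have dE : delta = / N by rewrite /N Rinv_inv.
have dpow t : Rpower delta (- t) = Rpower N t.
  by rewrite dE /Rpower ln_Rinv //; congr exp; ring.
have sA : INR (length A) <= Rpower N s + 1.
  rewrite INR_IZR_INZ cA dpow; apply: Rlt_le; exact: Rceil_lt.
have nA := pos_INR (length A).
set E1 := INR (covering_number delta (sumset B)).
set E2 := INR (covering_number delta (qform_set a1 a2 a3 B)).
have E10 : 0 <= E1 by exact: pos_INR.
have E20 : 0 <= E2 by exact: pos_INR.
rewrite Cinv dpow.
have Bpos : 0 < INR (length B).
  have dpos := Rpower_gt0 delta eps.
  have cpos : 0 < INR (length A).
    have : (0 < length A)%coq_nat; last exact: lt_0_INR.
    have h := Rpower_gt0 delta (- s); have [h1 _] := archimed (- Rpower delta (- s)).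
    suff : (0 < Z.of_nat (length A))%Z by lia.
    rewrite cA /Rceil.
    suff : (up (- Rpower delta (- s)) < 1)%Z by lia.
    have [_ h2] := archimed (- Rpower delta (- s)).
    by apply: lt_IZR; lra.
  by have := Rmult_lt_0_compat _ _ dpos cpos; lra.
have NsE := Rpower_gt0 N eps.
set X := c0 * / C * Rpower N eps * INR (length A).
case: (Rle_lt_dec X (E1 + E2)) => // ltX; exfalso.
have E11 : 1 <= E1.
  have [L [sL cL]] := sumset_cover B d0.
  rewrite /E1 -sL -[1]/(INR 1); apply: le_INR.
  case: (B) Bpos cL => [|b B' _ cL]; first by rewrite /=; lra.
  have [|c [cL' _]] := cL (b + b); first by exists b, b; split; [left|split; [left|]].
  by case: (L) cL' => //= *; lia.
have NN0 : N0 < N.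
  case: (Rlt_le_dec N0 N) => // NN0.
  have h1 : Rpower N eps <= INR k + 4 by rewrite -N0eps; apply: Rpower_mono.
  have h2 : INR (length A) <= Rpower N0 s + 1.
    by have := Rpower_mono (proj1 s01) N00 NN0; lra.
  have h3 := Rmult_le_compat _ _ _ _ (Rlt_le _ _ NsE) nA h1 h2.
  have h4 := Rmult_le_compat_l _ _ _ (Rlt_le _ _ c0pos) h3.
  have h5 : c0 * ((INR k + 4) * (Rpower N0 s + 1)) = / 8 by rewrite /c0; field; split; lra.
  have h6 : X = / C * (c0 * (Rpower N eps * INR (length A))) by rewrite /X; ring.
  have h7 : 0 <= c0 * (Rpower N eps * INR (length A)).
    by apply: Rmult_le_pos; [lra|apply: Rmult_le_pos; lra].
  have := Rmult_le_compat_r _ _ _ h7 (proj2 iC); lra.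
have N1 : 1 <= N by lra.
set n := INR (length B) in sB Bpos.
have nAB : INR (length A) <= Rpower N eps * n.
  have := Rmult_le_compat_l _ _ _ (Rlt_le _ _ NsE) sB.
  rewrite dE -Rmult_assoc Rpower_mult_distr; [|lra|exact: Rinv_0_lt_compat].
  by rewrite Rinv_r ?[Rpower 1 _]/Rpower ?ln_1 ?Rmult_0_r ?exp_0 ?Rmult_1_l; lra.
(* In the Frostman condition two of the four factors [N ^ eps] bound [C], one pays for passing from
   [A] to [B], and one for the constant 2 from enlarging an interval by a cell. *)
pose M := Rpower N (4 * eps).
have Npow2 : Rpower N eps * Rpower N eps = Rpower N (2 * eps).
  by rewrite -Rpower_plus; congr Rpower; ring.
have Npow4 : Rpower N (2 * eps) * Rpower N (2 * eps) = M.
  by rewrite -Rpower_plus; congr Rpower; ring.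
have Neps : INR k + 4 <= Rpower N eps by rewrite -N0eps; apply: Rpower_mono; lra.
have N2eps : (INR k + 4) * (INR k + 4) <= Rpower N (2 * eps).
  by rewrite -Npow2; apply: Rmult_le_compat; lra.
have M2 : 2 <= M by rewrite -Npow4; nra.
have MeN : M ^ e <= N.
  rewrite -Rpower_pow; last lra.
  rewrite /M Rpower_mult -[X in _ <= X]Rpower_1; last lra.
  apply: Rle_Rpower => //.
  have -> : 4 * eps * INR e = INR e / (INR e + 1) by rewrite /eps; field; lra.
  apply: (Rmult_le_reg_r (INR e + 1)); first lra.
  have -> : INR e / (INR e + 1) * (INR e + 1) = INR e by field; lra.
  lra.
set A' := [seq cell delta b | b <- B].
have sA' : INR (size A') = n by rewrite size_map.
have sepB : delta_separated delta B by move=> a b /BA aA /BA bA; exact: sepA.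
have NE : N = / delta by [].
have uA' : uniq A'.
  by apply: uniq_map_list => // a b aB bB; apply: (cell_inj d0 NE N1 sepB).
have A'0 : A' != [::] by apply/eqP => E; move: sA'; rewrite E /=; lra.
have XB : C * X <= c0 * Rpower N (2 * eps) * n.
  have -> : C * X = c0 * Rpower N eps * INR (length A) by rewrite /X; field; lra.
  rewrite -Npow2.
  have h0 : 0 <= c0 * Rpower N eps by nra.
  have := Rmult_le_compat_l _ _ _ h0 nAB; lra.
have E1X : E1 <= X by lra.
have E2X : E2 <= X by lra.
have X0 : 0 <= X by lra.
have XB' : X <= c0 * Rpower N (2 * eps) * n by apply: Rle_trans XB; nra.
have sums_le := sums_cells_le d0 NE N1 B; rewrite -/A' -/E1 in sums_le.
have n4 : n <= 4 * E1.
  apply: Rle_trans sums_le; rewrite -sA'; apply: INR_leq.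
  case: (A') A'0 uA' => // a A'' _ uA'.
  rewrite -(size_map (fun z => a + z)%Z); apply: uniq_leq_size.
    by rewrite map_inj_uniq // => x y h; lia.
  by move=> z /mapP[y yA ->]; apply: mem_sums; rewrite ?mem_head.
have CN : C <= Rpower N (2 * eps).
  have h1 : C * n <= 4 * (c0 * Rpower N (2 * eps) * n).
    apply: Rle_trans (_ : C * (4 * X) <= _); last lra.
    by apply: Rmult_le_compat_l; lra.
  have h2 : C * n <= Rpower N (2 * eps) * n.
    have : 0 <= Rpower N (2 * eps) * n by apply: Rmult_le_pos; nra.
    move=> h3; have := Rmult_le_compat_r _ _ _ h3 c08; lra.
  by apply: (Rmult_le_reg_r n).
have M0 : 0 < M by lra.
have N2 := Rpower_gt0 N (2 * eps).
have XM j : 0 <= j <= INR k + 4 -> X * j <= M * n.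
  move=> [j0 jk].
  have jN : j <= Rpower N (2 * eps) by nra.
  apply: Rle_trans (Rmult_le_compat _ _ _ _ X0 j0 XB' jN) _; rewrite -Npow4.
  have h : 0 <= Rpower N (2 * eps) * Rpower N (2 * eps) * n by apply: Rmult_le_pos; nra.
  have := Rmult_le_compat_r _ _ _ h c08.
  have : 0 <= c0 * (Rpower N (2 * eps) * Rpower N (2 * eps) * n) by apply: Rmult_le_pos; lra.
  lra.
have B01 b : In b B -> 0 <= b <= 1 by move=> /BA; exact: A01.
apply: (core M N A' (undup [seq floor (qf p1 p2 p3 (IZR x) (IZR y) / N) | x <- A', y <- A'])) => //.
- by move=> a /mem_map_list[b bB ->]; apply: (cell_range d0 NE N1); exact: B01.
- move=> x l l1 zs uz zA zx.
  have zA' : {subset zs <= [seq cell delta a | a <- A]}.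
    by move=> z /zA/mem_map_list[b /BA bA ->]; apply/mem_map_list; exists b.
  have h1 := INR_leq (count_in_cells d0 NE uz zA' zx).
  have ld : delta <= (l + 1) * delta by nra.
  have h2 := frA (x * delta) _ ld.
  have h3 : Rpower ((l + 1) * delta) s <= 2 * Rpower (l / N) s.
    apply: Rle_trans (_ : Rpower (2 * (l / N)) s <= _).
      apply: Rpower_mono; [lra|nra|].
      by rewrite dE /Rdiv; have := Rinv_0_lt_compat _ N00; nra.
    by apply: Rpower_scale; [lra|lra|apply: Rdiv_lt_0_compat; lra].
  rewrite sA'; apply: Rle_trans h1 _; apply: Rle_trans h2 _.
  have Rl := Rpower_gt0 (l / N) s.
  have h4 : C * Rpower ((l + 1) * delta) s <= C * (2 * Rpower (l / N) s) by apply: Rmult_le_compat_l; lra.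
  have h5 : C * (2 * Rpower (l / N) s) <= Rpower N (2 * eps) * (2 * Rpower (l / N) s).
    by apply: Rmult_le_compat_r; lra.
  have h6 := Rle_trans _ _ _ h4 h5.
  have h7 : 0 <= Rpower N (2 * eps) * (2 * Rpower (l / N) s) by nra.
  have h8 := Rmult_le_compat_r _ _ _ nA h6.
  have h9 := Rmult_le_compat_l _ _ _ h7 nAB.
  apply: Rle_trans h8 _; apply: Rle_trans h9 _.
  have h10 : 2 * Rpower N eps <= Rpower N (2 * eps).
    by rewrite -Npow2; apply: Rmult_le_compat_r; lra.
  have h11 : 0 <= Rpower N (2 * eps) * Rpower (l / N) s * n.
    by apply: Rmult_le_pos; [nra|lra].
  have := Rmult_le_compat_l _ _ _ h11 h10; rewrite -Npow4; lra.
- rewrite sA'; apply: Rle_trans (_ : INR (length A) <= _).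
    by apply/le_INR/NoDup_incl_length.
  have : 1 <= Rpower N s by rewrite -(Rpower_O N); [apply: Rle_Rpower; lra|lra].
  lra.
- rewrite sA'; apply: Rle_trans sums_le _.
  have := XM 4 ltac:(lra); lra.
- exact: undup_uniq.
- have := qform_cells_le d0 NE N1 q0 f1 f2 f3 (Rlt_le _ _ hk) B01; rewrite -/A' -/E2 sA' => h.
  apply: Rle_trans h _.
  have := XM (INR k) ltac:(lra); have := Rmult_le_compat_r _ _ _ k0 E2X; lra.
- move=> x y xA yA; rewrite mem_undup; apply/allpairsP; by exists (x, y).
Qed.
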